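(* Let $X\subset\mathbb{P}^1\times\mathbb{P}^1$ be a finite set of points, all of which lie on two distinct horizontal rulings, each containing at least one point of $X$. Then $X$ is a virtual complete intersection if and only if either (1) no two points of $X$ lie on the same vertical ruling, or (2) both horizontal rulings contain the same number of points of $X$.
   Context: Let $\Bbbk$ be an algebraically closed field; $\mathbb{P}^1\times\mathbb{P}^1$ is over $\Bbbk$, with projections $\pi_1,\pi_2$ to the first and second factor. A vertical ruling is a fiber of $\pi_1$ and a horizontal ruling is a fiber of $\pi_2$. The Cox ring is $S=\Bbbk[x_0,x_1,y_0,y_1]$, $\mathbb{Z}^2$-graded with $\deg x_i=(1,0)$ and $\deg y_i=(0,1)$, and $B=\langle x_0,x_1\rangle\cap\langle y_0,y_1\rangle$ is the irrelevant ideal. A set of points means a reduced zero-dimensional subscheme $X$ of $\mathbb{P}^1\times\mathbb{P}^1$; $I_X\subset S$ is the $B$-saturated bihomogeneous ideal of polynomials vanishing on $X$. A virtual resolution of $S/I$ ($I$ a bihomogeneous ideal) is a $\mathbb{Z}^2$-graded complex of free $S$-modules $F_\bullet=[F_0\xleftarrow{\varphi_1}F_1\xleftarrow{\varphi_2}F_2\leftarrow\cdots]$ such that for every $i\ge 1$ the annihilator of $H_i(F_\bullet)$ contains $B^\ell$ for some $\ell>0$, and the sheaves on $\mathbb{P}^1\times\mathbb{P}^1$ associated to $S/I$ and $\operatorname{coker}(\varphi_1)$ are isomorphic. The set $X$ is a virtual complete intersection (VCI) if $S/I_X$ has a virtual resolution that is the Koszul complex $K(f,g)$ of two bihomogeneous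 forms $f,g\in S$. *)

(* Defs.v *)
From HB Require Import structures.
From mathcomp Require Import all_boot all_order all_algebra.
From mathcomp Require Export finmap mpoly.

Set Implicit Arguments.
Unset Strict Implicit.
Unset Printing Implicit Defensive.

Import GRing.Theory.
Local Open Scope ring_scope.

(* The projective line: one-dimensional subspaces of K^2. *)
Definition P1 (K : fieldType) : Type := {L : {vspace 'rV[K]_2} | \dim L == 1%N}.
HB.instance Definition _ (K : fieldType) :=
  Choice.copy (P1 K) {L : {vspace 'rV[K]_2} | \dim L == 1%N}.

Notation P1xP1 K := (P1 K * P1 K)%type.

Definition vertical_ruling (K : fieldType) (a : P1 K) : pred (P1xP1 K) :=
  [pred p | p.1 == a].

Definition horizontal_ruling (K : fieldType) (b : P1 K) : pred (P1xP1 K) :=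
  [pred p | p.2 == b].

(* The variables of the Cox ring are ordered x_0, x_1, y_0, y_1. *)
Notation cox K := {mpoly K[2 + 2]}.

Section CoxRing.

Variable K : fieldType.
Notation S := (cox K).

Definition xvar (i : 'I_2) : S := 'X_(lshift 2 i).
Definition yvar (j : 'I_2) : S := 'X_(rshift 2 j).

Definition bideg (m : 'X_{1..2 + 2}) : int * int :=
  ((\sum_(i < 2) m (lshift 2 i))%N%:Z, (\sum_(j < 2) m (rshift 2 j))%N%:Z).

(* The zero polynomial is a form of every bidegree. *)
Definition bihomog (d : int * int) (p : S) : Prop :=
  forall m, m \in msupp p -> bideg m = d.

(** Ideals are represented by their membership predicates. *)

Definition ideal_gen n (g : 'I_n -> S) : S -> Prop :=
  fun p => exists c : 'I_n -> S, p = \sum_(i < n) c i * g i.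

Definition ideal_pow (I : S -> Prop) (l : nat) : S -> Prop :=
  fun p => exists n (c : 'I_n -> S) (b : 'I_n -> 'I_l -> S),
    (forall i j, I (b i j)) /\ p = \sum_(i < n) c i * \prod_(j < l) b i j.

Definition irrelevant_ideal : S -> Prop :=
  fun p => ideal_gen xvar p /\ ideal_gen yvar p.

(* A polynomial vanishes at (L, M) when it vanishes on the whole affine cone
   L x M in K^2 x K^2; over an infinite field this means that each of its
   bihomogeneous components vanishes at the point, so the ideal below is
   bihomogeneous. *)
Definition vanishing_ideal (X : {fset P1xP1 K}) : S -> Prop :=
  fun p => forall q, q \in X ->
    forall u v : 'rV[K]_2, u \in val q.1 -> v \in val q.2 ->
    p.@[row_mx u v 0] = 0.

(** Graded modules and their associated sheaves. *)

(* The graded module F / N, where F is the direct sum of the S(- d_i) for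
   i < gm_rk and d_i = gm_deg i, and N is the submodule gm_rel. *)
Record gmodule := GModule {
  gm_rk : nat;
  gm_deg : 'I_gm_rk -> int * int;
  gm_rel : 'rV[S]_gm_rk -> Prop }.

Definition free_homog n (d : 'I_n -> int * int) (e : int * int)
    (v : 'rV[S]_n) : Prop :=
  forall i, bihomog (e - d i) (v 0 i).

(* S / I, generated in bidegree 0 *)
Definition quotient_module (I : S -> Prop) : gmodule :=
  @GModule 1 (fun=> 0) (fun v => I (v 0 0)).

(* The open sets D(h), for h a form in the irrelevant ideal, are affine and are
   a basis of the Zariski topology of P^1 x P^1. The sheaf associated to a
   graded module M has as its sections over D(h) the degree-zero part of the
   localization M_h, and the structure sheaf is the case M = S. A fraction
   v / h^n is represented by the pair (v, n). *)
Definition basic_open (h : S) : Prop :=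
  irrelevant_ideal h /\ exists d, bihomog d h.

Definition frac (M : gmodule) : Type := ('rV[S]_(gm_rk M) * nat)%type.

Definition is_section (M : gmodule) (h : S) (s : frac M) : Prop :=
  exists e, bihomog e (h ^+ s.2) /\ free_homog (@gm_deg M) e s.1.

Definition section_eq (M : gmodule) (h : S) (s t : frac M) : Prop :=
  exists k : nat, gm_rel (h ^+ k *: (h ^+ t.2 *: s.1 - h ^+ s.2 *: t.1)).

Definition section_add (M : gmodule) (h : S) (s t : frac M) : frac M :=
  (h ^+ t.2 *: s.1 + h ^+ s.2 *: t.1, (s.2 + t.2)%N).

Definition is_function (h : S) (a : S * nat) : Prop :=
  exists e, bihomog e (h ^+ a.2) /\ bihomog e a.1.

Definition section_scale (M : gmodule) (a : S * nat) (s : frac M) : frac M :=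
  (a.1 *: s.1, (a.2 + s.2)%N).

(* D(h') is contained in D(h) iff h'^r = k h for some r and k; the restriction
   map is then v / h^n |-> k^n v / h'^(r n). *)
Definition section_res (M : gmodule) (r : nat) (k : S) (s : frac M) : frac M :=
  (k ^+ s.2 *: s.1, (r * s.2)%N).

(* An isomorphism of sheaves of modules, given on the basis of the D(h): linear
   bijections between the modules of sections, natural for restrictions. *)
Definition sheaf_iso (M N : gmodule) : Prop :=
  exists phi : S -> frac M -> frac N,
    (forall h, basic_open h ->
      [/\ forall s, is_section h s -> is_section h (phi h s),
          forall s t, is_section h s -> is_section h t ->
            (section_eq h (phi h s) (phi h t) <-> section_eq h s t),
          forall t, is_section h t ->
            exists2 s, is_section h s & section_eq h (phi h s) t,
          forall s t, is_section h s -> is_section h t ->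
            section_eq h (phi h (section_add h s t))
                         (section_add h (phi h s) (phi h t))
        & forall a s, is_function h a -> is_section h s ->
            section_eq h (phi h (section_scale a s))
                         (section_scale a (phi h s))]) /\
    (forall h h' r k, basic_open h -> basic_open h' -> h' ^+ r = k * h ->
      forall s, is_section h s ->
        section_eq h' (phi h' (section_res r k s)) (section_res r k (phi h s))).

(** Graded complexes of free modules and virtual resolutions. *)

(* F_i is the direct sum of the S(- d_j) for j < fc_rk i and d_j = fc_deg i j;
   its elements are row vectors, and the differential F_(i+1) -> F_i is right
   multiplication by fc_diff i. *)
Record free_complex := FreeComplex {
  fc_rk : nat -> nat;
  fc_deg : forall i, 'I_(fc_rk i) -> int * int;
  fc_diff : forall i, 'M[S]_(fc_rk i.+1, fc_rk i);
  fc_homog : forall i r c,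
    bihomog (@fc_deg i.+1 r - @fc_deg i c) (fc_diff i r c);
  fc_diffK : forall i, fc_diff i.+1 *m fc_diff i = 0 }.

(* s annihilates H_(i+1)(F) *)
Definition kills_homology (F : free_complex) (i : nat) (s : S) : Prop :=
  forall v : 'rV[S]_(fc_rk F i.+1), v *m fc_diff F i = 0 ->
    exists w : 'rV[S]_(fc_rk F i.+2), s *: v = w *m fc_diff F i.+1.

Definition coker_module (F : free_complex) : gmodule :=
  @GModule (fc_rk F 0) (@fc_deg F 0)
    (fun v => exists w : 'rV[S]_(fc_rk F 1), v = w *m fc_diff F 0).

Definition virtual_resolution (I : S -> Prop) (F : free_complex) : Prop :=
  (forall i, exists2 l, (0 < l)%N &
     forall s, ideal_pow irrelevant_ideal l s -> kills_homology F i s) /\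
  sheaf_iso (quotient_module I) (coker_module F).

(** The Koszul complex S <- S(-d) + S(-e) <- S(-d-e) of two forms. *)

Definition koszul_rk (i : nat) : nat :=
  match i with 0 => 1 | 1 => 2 | 2 => 1 | _ => 0 end.

Definition koszul_deg (d e : int * int) (i : nat) :
    'I_(koszul_rk i) -> int * int :=
  match i with
  | 0 => fun=> 0
  | 1 => fun j => if j == 0 :> nat then d else e
  | 2 => fun=> d + e
  | _ => fun=> 0
  end.

Definition koszul_diff (f g : S) (i : nat) :
    'M[S]_(koszul_rk i.+1, koszul_rk i) :=
  match i with
  | 0 => \matrix_(r < 2, c < 1) (if r == 0 :> nat then f else g)
  | 1 => \matrix_(r < 1, c < 2) (if c == 0 :> nat then - g else f)
  | _ => 0
  end.

Lemma bihomog0 d : bihomog d 0.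
Proof. by move=> m; rewrite msupp0. Qed.

Lemma bihomogN d p : bihomog d p -> bihomog d (- p).
Proof. by move=> hp m; rewrite (perm_mem (msuppN p)); apply: hp. Qed.

Lemma koszul_homog d e f g : bihomog d f -> bihomog e g ->
  forall i r c, bihomog (@koszul_deg d e i.+1 r - @koszul_deg d e i c)
                        (koszul_diff f g i r c).
Proof.
move=> hf hg [|[|i]] r c /=; rewrite mxE; last exact: bihomog0.
  by rewrite subr0; case: ifP.
case: ifP => _; last by rewrite addrK.
by rewrite [d + e]addrC addrK; apply: bihomogN.
Qed.

Lemma koszul_diffK f g i : koszul_diff f g i.+1 *m koszul_diff f g i = 0.
Proof.
case: i => [|i] /=; last by rewrite mul0mx.
apply/matrixP=> r c; rewrite !mxE !big_ord_recl big_ord0 !mxE /=.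
by rewrite addr0 mulNr mulrC addNr.
Qed.

Definition koszul d e f g (hf : bihomog d f) (hg : bihomog e g) :
    free_complex :=
  FreeComplex (koszul_homog hf hg) (koszul_diffK f g).

Definition virtual_complete_intersection (X : {fset P1xP1 K}) : Prop :=
  exists d e f g (hf : bihomog d f) (hg : bihomog e g),
    virtual_resolution (vanishing_ideal X) (koszul hf hg).

End CoxRing.

(* Main.v *)
From HB Require Import structures.
Require Import Defs.
From mathcomp Require Import all_boot all_order all_algebra.
From mathcomp Require Import finmap mpoly.
From mathcomp Require Import ring zify.

Set Implicit Arguments.
Unset Strict Implicit.
Unset Printing Implicit Defensive.

Import GRing.Theory.
Local Open Scope ring_scope.

(* Let A1, A2 be the sets of first coordinates of the points on the two
   rulings, l1, l2 the forms in y cutting out the rulings, and p1, p2 the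
   products of the linear forms in x attached to A1, A2.

   If |A1| = |A2|, then (l1 l2, p1 l2 + p2 l1) defines X; if A1 and A2 are
   disjoint, then (p1 p2, p2^|A1| l1 + p1^|A2| l2) does.  In both cases the
   first form is a product of distinct linear forms, none dividing the second,
   so the Koszul complex is exact.

   Conversely let f, g of bidegrees (d1, d2), (e1, e2) define X virtually.  The
   forms l1 l2, p1 l2, p2 l1 lie in (f, g) up to powers of the irrelevant ideal,
   and comparing dimensions in a large bidegree gives
   d1 e2 + d2 e1 <= |A1| + |A2|.
   If a lies in both A1 and A2, counting the zeros of f and g restricted to the
   rulings x = a, y = b1, y = b2 bounds the degrees from below, which leaves
   only |A1| = |A2|. *)

(** * Linear forms as prime elements *)

(** The virtual resolution supplies only an abstract isomorphism of sheaves, not the canonical map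
    between quotients of S. Locally a cyclic module determines its ideal as an annihilator, so
    comparing annihilators on the sets where x_i y_j is invertible still identifies the two ideals
    there; hence memberships are known only up to powers of x_i y_j.

    The degree bound needs no intersection multiplicities, just two one-sided estimates in a large
    bidegree: (f, g) has codimension at least d1 e2 + d2 e1, since multiples of f g are counted
    twice, while l1 l2, p1 l2, p2 l1 generate an ideal of codimension at most |A1| + |A2|.

    A common a puts two points of X on x = a, which forces degree at least 2 in y on a form that
    does not vanish identically there. This factor 2 turns the bound into 2 max(|A1|, |A2|) <= |A1|
    + |A2|, or into a contradiction.

    In the disjoint case the exponents |A1| and |A2| equalize bidegrees: both summands have degree
    |A1| |A2| in x. *)

Lemma meval_muni (R : comNzRingType) (n : nat) (p : {mpoly R[n.+1]})
    (w : 'I_n -> R) (t : R) :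
  (map_poly (meval w) (muni p)).[t]
    = p.@[fun i => if unlift ord_max i is Some j then w j else t].
Proof.
rewrite muniE mevalE rmorph_sum /= horner_sum; apply: eq_bigr => m _.
rewrite -mul_polyC rmorphM /= map_polyC /= map_polyXn.
rewrite hornerM hornerC hornerXn mevalZ mevalX -mulrA.
congr (_ * _); rewrite big_ord_recr /= unlift_none; congr (_ * _).
apply: eq_bigr => i _; rewrite mnmE.
have -> : widen_ord (leqnSn n) i = lift ord_max i.
  by apply: val_inj; rewrite /= /bump leqNgt ltn_ord.
by rewrite liftK.
Qed.

(** Each coefficient of p can be read off [muni p]: take the coefficient at the exponent of the last
    variable, then the one at the truncated monomial. *)
Lemma muni_inj0 (R : nzRingType) (n : nat) (p : {mpoly R[n.+1]}) :
  muni p = 0 -> p = 0.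
Proof.
move=> p0; apply/mpolyP => m; rewrite mcoeff0.
have := congr1 (fun q : {poly {mpoly R[n]}} =>
  (q`_(m ord_max))@_[multinom m (widen_ord (leqnSn n) i) | i < n]) p0.
rewrite coef0 mcoeff0 => <-.
rewrite {1}[p]mpolyE muniE !raddf_sum /= coef_sum raddf_sum /=.
apply: eq_bigr => k _.
rewrite coefZ coefXn mulr_natr mcoeffMn !mcoeffZ !mcoeffX.
case: eqP => [->|kNm]; first by rewrite !eqxx /= [RHS]mulr1n.
case: eqP => [e2|_]; last by rewrite /= !mulr0 mul0rn.
case: eqP => [e|_]; last by rewrite /= !mulr0.
case: kNm; apply/mnmP => i.
case: (unliftP ord_max i) => [j|] ->; last by rewrite e.
have -> : lift ord_max j = widen_ord (leqnSn n) j.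
  by apply: val_inj; rewrite /= /bump leqNgt ltn_ord.
by have := congr1 (fun x : 'X_{1..n} => x j) e2; rewrite !mnmE.
Qed.

(** Induction on the number of variables: specializing at a point where the leading coefficient of
    [muni p] is nonzero leaves a nonzero univariate polynomial, which has a nonroot since K is
    infinite. *)
Lemma mpoly_nonroot (K : closedFieldType) (n : nat) (p : {mpoly K[n]}) :
  p != 0 -> exists w, p.@[w] != 0.
Proof.
elim: n p => [|n IHn] p p0.
  exists (fun=> 0); apply: contra_neq p0; rewrite mevalE => pE.
  apply/mpolyP => m; rewrite mcoeff0.
  have [|/memN_msupp_eq0 //] := boolP (m \in msupp p).
  have mE (k : 'X_{1..0}) : k = m by apply/mnmP => - [].
  have := msupp_uniq p; move: pE; case: (msupp p) => [//|a [|b s]] pE.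
    move=> _ _; move: pE; rewrite big_seq1 (mE a) big_ord0 mulr1 //.
  by rewrite /= (mE a) (mE b) inE eqxx.
have q0 : muni p != 0 by apply: contra_neq p0; exact: muni_inj0.
have := q0; rewrite -lead_coef_eq0 => /IHn [w pw].
have : map_poly (meval w) (muni p) != 0.
  by rewrite map_poly_eq0_id0 // -[LHS]/(_ != 0).
case/closed_nonrootP => t; rewrite /root meval_muni => pwt.
by exists (fun i => if unlift ord_max i is Some j then w j else t).
Qed.

Lemma mpoly_zero (K : closedFieldType) (n : nat) (p : {mpoly K[n]}) :
  (forall w, p.@[w] = 0) -> p = 0.
Proof.
move=> p0; apply/eqP/negPn/negP => /mpoly_nonroot [w].
by rewrite p0 eqxx.
Qed.

Section LinearForms.

Variables (K : closedFieldType) (n : nat).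
Implicit Types (c : 'rV[K]_n) (p q : {mpoly K[n]}).

Definition linform c : {mpoly K[n]} := \sum_i c 0 i *: 'X_i.

Lemma meval_linform c w : (linform c).@[w] = \sum_i c 0 i * w i.
Proof.
by rewrite raddf_sum; apply: eq_bigr => i _; rewrite /= mevalZ mevalXU.
Qed.

Lemma meval_linform_sub c i0 w x :
  (linform c).@[fun i => w i - (i == i0)%:R * x] =
  (linform c).@[w] - c 0 i0 * x.
Proof.
rewrite !meval_linform; under eq_bigr do rewrite mulrBr; rewrite sumrB.
congr (_ - _); rewrite (bigD1 i0) //= big1 => [|i /negPf ->].
  by rewrite eqxx mul1r addr0.
by rewrite mul0r mulr0.
Qed.

Lemma meval_linform_proj c i0 w : c 0 i0 != 0 ->
  (linform c).@[fun i => w i - (i == i0)%:R * ((linform c).@[w] / c 0 i0)] = 0.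
Proof. by move=> c0; rewrite meval_linform_sub mulrC divfK ?subrr. Qed.

Definition divides p q := exists s, q = p * s.

(* The remainder r is p with X_i0 replaced by X_i0 - linform c / c_i0, a
   substitution that kills linform c; hence linform c is a prime element. *)
Lemma linform_div c i0 p : c 0 i0 != 0 ->
  exists s r, p = linform c * s + r /\
    forall w, r.@[w] =
      p.@[fun i => w i - (i == i0)%:R * ((linform c).@[w] / c 0 i0)].
Proof.
move=> c0; pose h (i : 'I_n) : {mpoly K[n]} :=
  'X_i - ((i == i0)%:R / c 0 i0) *: linform c.
pose D q := exists s, q = linform c * s + (q \mPo [tuple h i | i < n]).
have DM q1 q2 : D q1 -> D q2 -> D (q1 * q2).
  move=> [s1 e1] [s2 e2]; rewrite /D rmorphM /=.
  move: (q1 \mPo _) (q2 \mPo _) e1 e2 => r1 r2 -> ->.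
  by exists (s1 * (linform c * s2 + r2) + r1 * s2); ring.
have D1 : D 1 by exists 0; rewrite rmorph1; ring.
have DXU i : D 'X_i.
  exists ((i == i0)%:R / c 0 i0)%:MP.
  rewrite comp_mpolyXU -tnth_nth tnth_mktuple /h -mul_mpolyC; ring.
have DX m : D 'X_[m].
  rewrite mpolyXE_id; elim/big_ind: _ => // i _.
  by elim: (m i) => [|k IHk]; rewrite ?expr0 // exprS; apply: DM.
have : D p.
  elim/mpolyind: p => [|a m q _ _ [s e]].
    by exists 0; rewrite rmorph0; ring.
  have [s' e'] := DX m.
  exists (a *: s' + s); rewrite rmorphD /= linearZ /= {1}e' {1}e.
  by rewrite -!mul_mpolyC; ring.
move=> [s e]; exists s; exists (p \mPo [tuple h i | i < n]); split=> // w.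
rewrite comp_mpoly_meval; apply: meval_eq => i; rewrite tnth_mktuple /h.
rewrite mevalB mevalZ mevalXU; ring.
Qed.

Lemma linform_dvd c p : c != 0 ->
  (forall w, (linform c).@[w] = 0 -> p.@[w] = 0) -> divides (linform c) p.
Proof.
move=> /rV0Pn [i0 c0] p0; have [s [r [pe re]]] := linform_div p c0.
exists s; rewrite pe [X in _ + X](mpoly_zero (p := r)) ?addr0 // => w.
rewrite re; apply: p0; exact: meval_linform_proj.
Qed.

(** At any w the product of the two remainders equals [p * q] at a point of the hyperplane
    [linform c] = 0, hence is 0; one remainder is then zero because the polynomial ring is a
    domain. *)
Lemma linform_prime c p q : c != 0 -> divides (linform c) (p * q) ->
  divides (linform c) p \/ divides (linform c) q.
Proof.
move=> /rV0Pn [i0 c0] [s pq].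
have [sp [rp [pe rpe]]] := linform_div p c0.
have [sq [rq [qe rqe]]] := linform_div q c0.
have /eqP : rp * rq = 0.
  apply: mpoly_zero => w; rewrite mevalM rpe rqe -mevalM pq mevalM.
  by rewrite meval_linform_proj ?mul0r.
rewrite mulf_eq0 => /orP [] /eqP r0.
  by left; exists sp; rewrite pe r0 addr0.
by right; exists sq; rewrite qe r0 addr0.
Qed.

Lemma linform_neq0 c : c != 0 -> linform c != 0.
Proof.
move=> /rV0Pn [i0 c0]; apply: contra c0 => /eqP /(congr1 (mcoeff U_(i0))).
rewrite mcoeff0 raddf_sum /= (bigD1 i0) //= big1 => [|i /negPf ii0].
  by rewrite addr0 mcoeffZ mcoeffXU eqxx mulr1 => ->.
by rewrite mcoeffZ mcoeffXU ii0 mulr0.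
Qed.

Section Products.

Variables (T : eqType) (F : T -> 'rV[K]_n) (s : seq T).
Hypothesis F_neq0 : forall a, a \in s -> F a != 0.

Lemma prod_linform_neq0 : \prod_(a <- s) linform (F a) != 0.
Proof.
by rewrite prodf_seq_neq0; apply/allP => a /F_neq0 /linform_neq0.
Qed.

Lemma prod_linform_dvd p : uniq s ->
  (forall a b, a \in s -> b \in s -> a != b ->
     ~ divides (linform (F a)) (linform (F b))) ->
  (forall a, a \in s -> divides (linform (F a)) p) ->
  divides (\prod_(a <- s) linform (F a)) p.
Proof.
elim: s F_neq0 p => [|a r IHr] Fr p /=.
  by exists p; rewrite big_nil mul1r.
case/andP => a_r r_uniq ndvd dvd; rewrite big_cons.
have [p' pe] := dvd a (mem_head _ _).
have Fr' b : b \in r -> F b != 0 by move=> br; apply: Fr; rewrite inE br orbT.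
have [||p'' p'e] := IHr Fr' p' r_uniq.
- by move=> b b' br b'r; apply: ndvd; rewrite inE ?br ?b'r orbT.
- move=> b br; have b_ar : b \in a :: r by rewrite inE br orbT.
  have := dvd b b_ar; rewrite pe => /linform_prime [|/ndvd ab|//].
    exact: Fr.
  by case: ab => //; [exact: mem_head | apply: contraNneq a_r => <-].
by exists p''; rewrite pe p'e mulrA.
Qed.

(** Exactness of the Koszul complex at its middle term. Each prime factor of f divides [q * g] but
    not g, so it divides q; the factors being pairwise non-associate, f divides q. *)
Lemma prod_linform_koszul g p q : uniq s ->
  (forall a b, a \in s -> b \in s -> a != b ->
     ~ divides (linform (F a)) (linform (F b))) ->
  (forall a, a \in s -> ~ divides (linform (F a)) g) ->
  p * \prod_(a <- s) linform (F a) + q * g = 0 ->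
  exists w, p = - (w * g) /\ q = w * \prod_(a <- s) linform (F a).
Proof.
move=> s_uniq ndvd gndvd; set f := \prod_(_ <- _) _ => /eqP.
rewrite addr_eq0 => /eqP pf.
have [w qe] : divides f q.
  apply: prod_linform_dvd => // a a_s.
  have : divides (linform (F a)) (q * g).
    rewrite -[q * g]opprK -pf /f (big_rem a) //=; set f' := \prod_(_ <- _) _.
    by exists (- (p * f')); ring.
  by case/linform_prime => [|//|/gndvd //]; exact: F_neq0.
exists w; split; last by rewrite qe mulrC.
by apply: (mulIf prod_linform_neq0); rewrite -/f pf qe; ring.
Qed.

End Products.

End LinearForms.

(** * Lines, evaluation and bihomogeneous forms *)

Lemma big_ord2 (R : Type) (idx : R) (op : Monoid.law idx) (F : 'I_2 -> R) :
  \big[op/idx]_(i < 2) F i = op (F 0) (F 1).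
Proof.
rewrite !big_ord_recl big_ord0 Monoid.mulm1; congr (op (F _) (F _)).
by apply: val_inj.
Qed.

Section Lines.

Variable K : fieldType.
Implicit Types (a b : P1 K) (u v : 'rV[K]_2).

Definition rep a : 'rV[K]_2 := vpick (val a).

Lemma rep_mem a : rep a \in val a.
Proof. exact: memv_pick. Qed.

Lemma rep_neq0 a : rep a != 0.
Proof. by rewrite vpick0 -dimv_eq0 (eqP (valP a)). Qed.

Lemma lineE a : val a = <[rep a]>%VS.
Proof.
apply/esym/eqP; rewrite eqEdim -memvE rep_mem (eqP (valP a)) dim_vline.
by rewrite rep_neq0.
Qed.

Definition perp a : 'rV[K]_2 :=
  \row_i (if i == 0 then rep a 0 1 else - rep a 0 0).

(** The 2 x 2 determinant of u and [rep a]: a linear form in u whose zero set is the line a, with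
    coefficient vector [perp a]. *)
Definition ldot a u := rep a 0 1 * u 0 0 - rep a 0 0 * u 0 1.

Lemma rV2P u v : u 0 0 = v 0 0 -> u 0 1 = v 0 1 -> u = v.
Proof.
move=> e0 e1; apply/rowP => i; case: (unliftP 0 i) => [j|] -> //.
by rewrite (_ : lift 0 j = 1) //; apply: val_inj; rewrite /= (ord1 j).
Qed.

Lemma mem_line a u : (u \in val a) = (ldot a u == 0).
Proof.
rewrite lineE; apply/vlineP/eqP => [[k ->]|du].
  by rewrite /ldot !mxE; ring.
have [r0|r0] := eqVneq (rep a 0 0) 0.
  have r1 : rep a 0 1 != 0.
    by apply: contra_neq (rep_neq0 a) => r1; apply: rV2P; rewrite mxE.
  exists (u 0 1 / rep a 0 1); apply: rV2P; rewrite !mxE ?divfK // r0 mulr0.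
  move: du; rewrite /ldot r0 mul0r subr0 => /eqP.
  by rewrite mulf_eq0 (negPf r1) => /eqP.
exists (u 0 0 / rep a 0 0); apply: rV2P; rewrite !mxE ?divfK //.
have e : rep a 0 1 * u 0 0 = rep a 0 0 * u 0 1.
  by apply/eqP; rewrite -subr_eq0 -/(ldot a u) du.
by apply: (mulfI r0); rewrite -e; field.
Qed.

Lemma ldot_rep a : ldot a (rep a) = 0.
Proof. by apply/eqP; rewrite -mem_line rep_mem. Qed.

Lemma ldot_rep_eq0 a b : (ldot a (rep b) == 0) = (a == b).
Proof.
apply/idP/eqP => [|->]; last by rewrite ldot_rep.
rewrite -mem_line => b_a; apply/val_inj/esym/eqP.
by rewrite eqEdim (eqP (valP a)) (eqP (valP b)) andbT lineE -memvE.
Qed.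

End Lines.

Section Forms.

Variable K : closedFieldType.
Implicit Types (a b : P1 K) (u v : 'rV[K]_2) (p q f g : cox K).

Definition xvec a : 'rV[K]_(2 + 2) := row_mx (perp a) 0.
Definition yvec a : 'rV[K]_(2 + 2) := row_mx 0 (perp a).

Local Notation xform a := (linform (xvec a)).
Local Notation yform a := (linform (yvec a)).

Definition ev p u v : K := p.@[row_mx u v 0].

Lemma ev_xform a u v : ev (xform a) u v = ldot a u.
Proof.
rewrite /ev meval_linform big_split_ord /= [X in _ + X]big1 => [|i _].
  rewrite addr0 big_ord2 /= !row_mxEl !mxE /=.
  by rewrite mulNr /ldot.
by rewrite [xvec _ _ _]row_mxEr mxE mul0r.
Qed.

Lemma ev_yform a u v : ev (yform a) u v = ldot a v.
Proof.
rewrite /ev meval_linform big_split_ord /= [X in X + _]big1 => [|i _].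
  rewrite add0r big_ord2 /= !row_mxEr !mxE /=.
  by rewrite mulNr /ldot.
by rewrite [yvec _ _ _]row_mxEl mxE mul0r.
Qed.

Lemma row_mxP (w : 'I_(2 + 2) -> K) : exists u v, w =1 row_mx u v 0.
Proof.
exists (\row_i w (lshift 2 i)), (\row_i w (rshift 2 i)) => i.
case: (split_ordP i) => j ->; first by rewrite row_mxEl mxE.
by rewrite row_mxEr mxE.
Qed.

Lemma evP p w : exists u v, p.@[w] = ev p u v.
Proof.
by have [u [v wE]] := row_mxP w; exists u, v; exact: meval_eq.
Qed.

Lemma perp_neq0 a : perp a != 0.
Proof.
apply: contra_neq (rep_neq0 a) => /rowP p0; apply: rV2P; rewrite mxE.
  by have := p0 1; rewrite !mxE /= => /eqP; rewrite oppr_eq0 => /eqP.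
by have := p0 0; rewrite !mxE.
Qed.

Lemma xvec_neq0 a : xvec a != 0.
Proof. by rewrite /xvec row_mx_eq0 negb_and perp_neq0. Qed.

Lemma yvec_neq0 a : yvec a != 0.
Proof. by rewrite /yvec row_mx_eq0 negb_and perp_neq0 orbT. Qed.

Lemma evM p q u v : ev (p * q) u v = ev p u v * ev q u v.
Proof. exact: mevalM. Qed.

Lemma evD p q u v : ev (p + q) u v = ev p u v + ev q u v.
Proof. exact: mevalD. Qed.

Lemma evXn p n u v : ev (p ^+ n) u v = ev p u v ^+ n.
Proof. exact: rmorphXn. Qed.

Lemma ev_prod_xform (s : seq (P1 K)) u v :
  ev (\prod_(a <- s) xform a) u v = \prod_(a <- s) ldot a u.
Proof. by rewrite /ev rmorph_prod; apply: eq_bigr => a _; exact: ev_xform. Qed.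

Lemma divides_ev p q u v : divides p q -> ev p u v = 0 -> ev q u v = 0.
Proof. by case=> s ->; rewrite evM => ->; rewrite mul0r. Qed.

Lemma xform_ndvd a b : a != b -> ~ divides (xform a) (xform b).
Proof.
move=> ab /(divides_ev (u := rep a) (v := 0)); rewrite !ev_xform ldot_rep.
by move/(_ erefl)/eqP; rewrite ldot_rep_eq0 eq_sym (negPf ab).
Qed.

Lemma yform_ndvd a b : a != b -> ~ divides (yform a) (yform b).
Proof.
move=> ab /(divides_ev (u := 0) (v := rep a)); rewrite !ev_yform ldot_rep.
by move/(_ erefl)/eqP; rewrite ldot_rep_eq0 eq_sym (negPf ab).
Qed.

Lemma prod_xform_neq0 (s : seq (P1 K)) : \prod_(a <- s) xform a != 0.
Proof. by apply: prod_linform_neq0 => a _; exact: xvec_neq0. Qed.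

Lemma bideg_add (m k : 'X_{1..2 + 2}) : bideg (m + k)%MM = bideg m + bideg k.
Proof.
rewrite /bideg !big_ord2 !mnmDE; congr (_, _) => /=; lia.
Qed.

Lemma bihomogD d p q : bihomog d p -> bihomog d q -> bihomog d (p + q).
Proof.
move=> hp hq m /msuppD_le; rewrite mem_cat => /orP [/hp|/hq] //.
Qed.

Lemma bihomogM d e p q : bihomog d p -> bihomog e q -> bihomog (d + e) (p * q).
Proof.
move=> hp hq m /msuppM_le /allpairsP [[m1 m2] /= [/hp <- /hq <- ->]].
exact: bideg_add.
Qed.

Lemma bihomogM_nat s1 t1 s2 t2 s t p q :
  bihomog (s1%:Z, t1%:Z) p -> bihomog (s2%:Z, t2%:Z) q ->
  s = (s1 + s2)%N -> t = (t1 + t2)%N -> bihomog (s%:Z, t%:Z) (p * q).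
Proof. by move=> hp hq -> ->; exact: (bihomogM hp hq). Qed.

Lemma bihomogZ d c p : bihomog d p -> bihomog d (c *: p).
Proof. by move=> hp m /msuppZ_le /hp. Qed.

Lemma bihomogX m : bihomog (bideg m) ('X_[m] : cox K).
Proof. by move=> k; rewrite msuppX inE => /eqP ->. Qed.

Lemma bihomog1 : bihomog 0 (1 : cox K).
Proof.
move=> m; rewrite msupp1 inE => /eqP ->; rewrite /bideg.
by rewrite !big1 // => i _; rewrite mnmE.
Qed.

Lemma bihomog_sum d (I : Type) (r : seq I) (F : I -> cox K) :
  (forall i, bihomog d (F i)) -> bihomog d (\sum_(i <- r) F i).
Proof.
by move=> hF; elim/big_ind: _ => //; [exact: bihomog0 | exact: bihomogD].
Qed.

Lemma bihomog_xvar i : bihomog (1%:Z, 0%:Z) (xvar K i).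
Proof.
suff <- : bideg U_(lshift 2 i) = (1%:Z, 0%:Z) by exact: bihomogX.
rewrite /bideg; congr (_%:Z, _%:Z).
  rewrite (bigD1 i) //= big1 ?mnm1E ?eqxx // => j /negPf ji.
  by rewrite mnm1E (inj_eq (@lshift_inj _ _)) eq_sym ji.
by rewrite big1 // => j _; rewrite mnm1E eq_lrshift.
Qed.

Lemma bihomog_yvar i : bihomog (0%:Z, 1%:Z) (yvar K i).
Proof.
suff <- : bideg U_(rshift 2 i) = (0%:Z, 1%:Z) by exact: bihomogX.
rewrite /bideg; congr (_%:Z, _%:Z).
  by rewrite big1 // => j _; rewrite mnm1E eq_rlshift.
rewrite (bigD1 i) //= big1 ?mnm1E ?eqxx // => j /negPf ji.
by rewrite mnm1E (inj_eq (@rshift_inj _ _)) eq_sym ji.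
Qed.

Lemma xformE a : xform a = rep a 0 1 *: xvar K 0 - rep a 0 0 *: xvar K 1.
Proof.
rewrite /linform big_split_ord /= [X in _ + X]big1 => [|i _].
  by rewrite addr0 big_ord2 /= !row_mxEl !mxE /= scaleNr.
by rewrite row_mxEr mxE scale0r.
Qed.

Lemma yformE a : yform a = rep a 0 1 *: yvar K 0 - rep a 0 0 *: yvar K 1.
Proof.
rewrite /linform big_split_ord /= [X in X + _]big1 => [|i _].
  by rewrite add0r big_ord2 /= !row_mxEr !mxE /= scaleNr.
by rewrite row_mxEl mxE scale0r.
Qed.

Lemma bihomog_xform a : bihomog (1%:Z, 0%:Z) (xform a).
Proof.
rewrite xformE; apply: bihomogD; first exact/bihomogZ/bihomog_xvar.
exact/bihomogN/bihomogZ/bihomog_xvar.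
Qed.

Lemma bihomog_yform a : bihomog (0%:Z, 1%:Z) (yform a).
Proof.
rewrite yformE; apply: bihomogD; first exact/bihomogZ/bihomog_yvar.
exact/bihomogN/bihomogZ/bihomog_yvar.
Qed.

End Forms.

Arguments bihomog_xvar {K} i.
Arguments bihomog_yvar {K} i.
Arguments bihomog_xform {K} a.
Arguments bihomog_yform {K} a.

Lemma bihomog_prod_xform (K : closedFieldType) (s : seq (P1 K)) :
  bihomog ((size s)%:Z, 0%:Z) (\prod_(a <- s) linform (xvec a)).
Proof.
elim: s => [|a s IHs]; first by rewrite big_nil; exact: bihomog1.
rewrite big_cons.
by apply: (bihomogM_nat (bihomog_xform a) IHs).
Qed.

Arguments bihomog_prod_xform {K} s.

Local Notation xform a := (linform (xvec a)).
Local Notation yform a := (linform (yvec a)).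

(** * Graded pieces *)

Section GradedPieces.

Variable K : closedFieldType.
Implicit Types (p q f g h : cox K) (s t : nat).

Definition bmon s t (i : 'I_s.+1) (j : 'I_t.+1) : 'X_{1..2 + 2} :=
  [multinom nth 0%N [:: val i; (s - i)%N; val j; (t - j)%N] k | k < 2 + 2].

Lemma bideg_nat (m : 'X_{1..2 + 2}) s t :
  bideg m = (s%:Z, t%:Z) <->
  (m (lshift 2 0%R) + m (lshift 2 1%R) = s)%N /\
  (m (rshift 2 0%R) + m (rshift 2 1%R) = t)%N.
Proof.
rewrite /bideg !big_ord2 /=; split=> [[-> ->] //|[-> ->] //].
Qed.

Lemma bmon_bideg s t i j : bideg (@bmon s t i j) = (s%:Z, t%:Z).
Proof.
by apply/bideg_nat; rewrite !mnmE /=; split; rewrite subnKC // -ltnS.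
Qed.

Lemma mnm4P (m k : 'X_{1..2 + 2}) :
  m (lshift 2 0) = k (lshift 2 0) -> m (lshift 2 1) = k (lshift 2 1) ->
  m (rshift 2 0) = k (rshift 2 0) -> m (rshift 2 1) = k (rshift 2 1) -> m = k.
Proof.
move=> e0 e1 e2 e3; apply/mnmP => i.
have D (j : 'I_2) : j = 0 \/ j = 1.
  by case: j => - [|[|//]] ?; [left | right]; apply: val_inj.
by case: (split_ordP i) => j ->; case: (D j) => ->.
Qed.

Lemma bmonP m s t : bideg m = (s%:Z, t%:Z) -> exists i j, m = @bmon s t i j.
Proof.
move=> /bideg_nat [ms mt].
have is_ : (m (lshift 2 0%R) < s.+1)%N by rewrite -ms ltnS leq_addr.
have jt : (m (rshift 2 0%R) < t.+1)%N by rewrite -mt ltnS leq_addr.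
by exists (Ordinal is_), (Ordinal jt); apply: mnm4P; rewrite !mnmE //=;
  rewrite -?ms -?mt addKn.
Qed.

Lemma bmon_inj s t i j i' j' : @bmon s t i j = bmon i' j' -> i = i' /\ j = j'.
Proof.
move=> /mnmP e; split; apply: val_inj.
  by have := e (lshift 2 0); rewrite !mnmE.
by have := e (rshift 2 0); rewrite !mnmE.
Qed.

(** Identifies the forms of bidegree (s, t) with a matrix space, so that dimensions of subspaces can
    be computed there; [coefs] is the inverse. *)
Definition form_of s t (A : 'M[K]_(s.+1, t.+1)) : cox K :=
  \sum_i \sum_j A i j *: 'X_[bmon i j].

Definition coefs s t p : 'M[K]_(s.+1, t.+1) := \matrix_(i, j) p@_(bmon i j).

Lemma form_of_bihomog s t (A : 'M[K]_(s.+1, t.+1)) :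
  bihomog (s%:Z, t%:Z) (form_of A).
Proof.
apply: bihomog_sum => i; apply: bihomog_sum => j; apply: bihomogZ.
by rewrite -(bmon_bideg i j); exact: bihomogX.
Qed.

Lemma mcoeff_form_of s t (A : 'M[K]_(s.+1, t.+1)) i j :
  (form_of A)@_(bmon i j) = A i j.
Proof.
rewrite raddf_sum (bigD1 i) //= raddf_sum (bigD1 j) //= mcoeffZ mcoeffX eqxx.
rewrite mulr1 !big1 ?addr0 // => [i' ii'|j' jj'].
  rewrite raddf_sum big1 // => j' _; rewrite /= mcoeffZ mcoeffX.
  case: eqP => [/bmon_inj [e _]|_]; last by rewrite mulr0.
  by rewrite e eqxx in ii'.
rewrite mcoeffZ mcoeffX.
case: eqP => [/bmon_inj [_ e]|_]; last by rewrite mulr0.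
by rewrite e eqxx in jj'.
Qed.

Lemma form_ofK s t : cancel (@form_of s t) (coefs s t).
Proof. by move=> A; apply/matrixP => i j; rewrite mxE mcoeff_form_of. Qed.

Lemma bihomog_mcoeff0 d p m : bihomog d p -> bideg m != d -> p@_m = 0.
Proof.
by move=> hp md; apply: memN_msupp_eq0; apply: contra md => /hp ->.
Qed.

Lemma coefsK s t p : bihomog (s%:Z, t%:Z) p -> form_of (coefs s t p) = p.
Proof.
move=> hp; apply/mpolyP => m.
have [/bmonP [i [j ->]]|mst] := eqVneq (bideg m) (s%:Z, t%:Z).
  by rewrite mcoeff_form_of mxE.
by rewrite !(bihomog_mcoeff0 _ mst) //; exact: form_of_bihomog.
Qed.

Lemma coefs_is_linear s t : linear (coefs s t).
Proof. by move=> a p q; apply/matrixP => i j; rewrite !mxE mcoeffD mcoeffZ. Qed.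

HB.instance Definition _ s t := GRing.isLinear.Build K (cox K)
  'M[K]_(s.+1, t.+1) _ (coefs s t) (@coefs_is_linear s t).

Lemma form_of_is_linear s t : linear (@form_of s t).
Proof.
move=> a A A'; rewrite /form_of scaler_sumr -big_split /=.
apply: eq_bigr => i _; rewrite scaler_sumr -big_split /=.
by apply: eq_bigr => j _; rewrite !mxE scalerDl scalerA.
Qed.

HB.instance Definition _ s t := GRing.isLinear.Build K
  'M[K]_(s.+1, t.+1) (cox K) _ (@form_of s t) (@form_of_is_linear s t).

(** As f is a form, only the component of c of bidegree (s, t) contributes; arbitrary cofactors in
    an ideal membership may thus be replaced by bihomogeneous ones. *)
Lemma coefs_mul s t d1 d2 c f : bihomog (d1%:Z, d2%:Z) f ->
  coefs (s + d1) (t + d2) (c * f) =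
  coefs (s + d1) (t + d2) (form_of (coefs s t c) * f).
Proof.
move=> hf; apply/eqP; rewrite -subr_eq0 -raddfB /= -mulrBl; apply/eqP.
set r := c - _; apply/matrixP => i j; rewrite !mxE.
apply: memN_msupp_eq0; apply/negP => /msuppM_le /allpairsP [[m k] /= [mr kf e]].
have := bmon_bideg i j; rewrite e bideg_add (hf _ kf) => mst.
have {mst} : bideg m = (s%:Z, t%:Z).
  move: mst; case: (bideg m) => x y [ex ey].
  by congr (_, _); move: ex ey; rewrite /= !PoszD => /addIr + /addIr.
case/bmonP => i' [j' me]; move: mr; rewrite mcoeff_msupp me.
by rewrite /r mcoeffB mcoeff_form_of mxE subrr eqxx.
Qed.

Section Multiples.

Variables (s' t' : nat).

(** The target bidegree (s', t') is a free parameter, tied to (s, t) only by later equations, so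
    that the multiples of different forms lie in one space and can be added and intersected. *)
Definition mulform h s t (A : 'M[K]_(s.+1, t.+1)) : 'M[K]_(s'.+1, t'.+1) :=
  coefs s' t' (form_of A * h).

Lemma mulform_is_linear h s t : linear (@mulform h s t).
Proof.
by move=> a A A'; rewrite /mulform !linearP /= mulrDl -scalerAl linearP.
Qed.

HB.instance Definition _ h s t := GRing.isLinear.Build K
  'M[K]_(s.+1, t.+1) 'M[K]_(s'.+1, t'.+1) _ (@mulform h s t)
  (@mulform_is_linear h s t).

Definition multiples h s t : {vspace 'M[K]_(s'.+1, t'.+1)} :=
  limg (linfun (@mulform h s t)).

Variables (h : cox K) (s t d1 d2 : nat).
Hypotheses (hh : bihomog (d1%:Z, d2%:Z) h) (h_neq0 : h != 0).
Hypotheses (s'E : s' = (s + d1)%N) (t'E : t' = (t + d2)%N).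

Lemma bihomog_mul q : bihomog (s%:Z, t%:Z) q -> bihomog (s'%:Z, t'%:Z) (q * h).
Proof.
move=> hq; rewrite s'E t'E (_ : (_, _) = (s%:Z, t%:Z) + (d1%:Z, d2%:Z)) //.
exact: bihomogM.
Qed.

Lemma form_of_mulform (A : 'M[K]_(s.+1, t.+1)) :
  form_of (mulform h A) = form_of A * h.
Proof. by rewrite coefsK //; apply: bihomog_mul; exact: form_of_bihomog. Qed.

Lemma dim_multiples : \dim (multiples h s t) = (s.+1 * t.+1)%N.
Proof.
rewrite /multiples limg_dim_eq ?dimvf ?dim_matrix //.
apply/eqP; rewrite -subv0; apply/subvP => A; rewrite memv_cap memvf memv_ker.
rewrite lfunE /= => /eqP /(congr1 (@form_of _ _)).
rewrite form_of_mulform linear0 => /eqP; rewrite mulf_eq0 (negPf h_neq0) orbF.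
by move/eqP => A0; rewrite memv0 -[A]form_ofK A0 linear0.
Qed.

Lemma multiplesP P : reflect
  (exists2 q, bihomog (s%:Z, t%:Z) q & form_of P = q * h) (P \in multiples h s t).
Proof.
apply: (iffP memv_imgP) => [[A _ ->]|[q hq e]].
  rewrite lfunE /= form_of_mulform; exists (form_of A) => //.
  exact: form_of_bihomog.
exists (coefs s t q); first exact: memvf.
rewrite lfunE; apply: (can_inj (@form_ofK _ _)).
by rewrite form_of_mulform e coefsK.
Qed.

Lemma coefs_multiples c : coefs s' t' (c * h) \in multiples h s t.
Proof.
apply/memv_imgP; exists (coefs s t c); first exact: memvf.
by rewrite lfunE /= /mulform s'E t'E coefs_mul.
Qed.

End Multiples.

End GradedPieces.

(** * The Bezout inequality *)


Section Ideal2.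

Variables (R : comNzRingType).
Implicit Types (f g p q : R).

Definition ideal2 f g p := exists c d, p = c * f + d * g.

Lemma ideal2D f g p q : ideal2 f g p -> ideal2 f g q -> ideal2 f g (p + q).
Proof.
by move=> [c [d ->]] [c' [d' ->]]; exists (c + c'), (d + d'); ring.
Qed.

Lemma ideal2Ml f g p q : ideal2 f g p -> ideal2 f g (q * p).
Proof. by move=> [c [d ->]]; exists (q * c), (q * d); ring. Qed.

Lemma ideal2_0 f g : ideal2 f g 0.
Proof. by exists 0, 0; ring. Qed.

Lemma comb0 (x y p q : R) : x = 0 -> y = 0 -> x * p + y * q = 0.
Proof. by move=> -> ->; rewrite !mul0r addr0. Qed.

End Ideal2.

Lemma bihomog_yexp (K : closedFieldType) (l : cox K) k :
  bihomog (0%:Z, 1%:Z) l -> bihomog (0%:Z, k%:Z) (l ^+ k).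
Proof.
move=> hl; elim: k => [|k IHk]; first by rewrite expr0; exact: bihomog1.
by rewrite exprS; exact: (bihomogM_nat hl IHk).
Qed.

Section Bezout.

Variable K : closedFieldType.
Implicit Types (p q f g h : cox K) (s t : nat) (u v : 'rV[K]_2).

Lemma ev_ydeg0 p s u v v' : bihomog (s%:Z, 0) p -> ev p u v = ev p u v'.
Proof.
move=> hp; rewrite /ev !mevalE !big_seq; apply: eq_bigr => m /hp.
move/(@bideg_nat _ s 0) => [_ /eqP]; rewrite addn_eq0 => /andP [/eqP m0 /eqP m1].
congr (_ * _); rewrite !big_split_ord /=; congr (_ * _).
  by apply: eq_bigr => i _; rewrite !row_mxEl.
by rewrite !big_ord2 /= m0 m1 !expr0.
Qed.

(** Pigeonhole: a monomial of degree at least 2N in x and in y is divisible by some (x_i y_j)^N. *)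
Lemma ideal2_high_degree f g p N :
  (forall i j, ideal2 f g ((xvar K i * yvar K j) ^+ N * p)) ->
  forall q s t, bihomog (s%:Z, t%:Z) q -> (N.*2 <= s)%N -> (N.*2 <= t)%N ->
  ideal2 f g (q * p).
Proof.
move=> hN q s t hq Ns Nt; rewrite [q]mpolyE mulr_suml.
rewrite big_seq; elim/big_ind: _ => [||m /hq /bideg_nat [ms mt]].
- exact: ideal2_0.
- exact: ideal2D.
have [i Ni] : exists i : 'I_2, (N <= m (lshift 2 i))%N.
  have [|lt0] := leqP N (m (lshift 2 (0 : 'I_2))); first by exists 0.
  by exists 1; lia.
have [j Nj] : exists j : 'I_2, (N <= m (rshift 2 j))%N.
  have [|lt0] := leqP N (m (rshift 2 (0 : 'I_2))); first by exists 0.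
  by exists 1; lia.
pose k := ((U_(lshift 2 i) + U_(rshift 2 j)) *+ N)%MM : 'X_{1..2 + 2}.
have km : (k <= m)%MM.
  apply/mnm_lepP => l; rewrite mulmnE mnmDE !mnm1E.
  case: eqP => [<-|_]; first by rewrite eq_rlshift /= addn0 mul1n.
  case: eqP => [<-|_] //=; by rewrite add0n mul1n.
rewrite -(submK km) mpolyXD -scalerAl -mulrA -mul_mpolyC.
do 2 apply: ideal2Ml.
by rewrite -mpolyXn mpolyXD; exact: hN.
Qed.

Lemma ideal2_uniform f g p :
  (forall i j, exists k, ideal2 f g ((xvar K i * yvar K j) ^+ k * p)) ->
  exists N, forall M, (N <= M)%N ->
    forall i j, ideal2 f g ((xvar K i * yvar K j) ^+ M * p).
Proof.
move=> h.
have /fin_all_exists [k hk] : forall ij : 'I_2 * 'I_2, exists k,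
    ideal2 f g ((xvar K ij.1 * yvar K ij.2) ^+ k * p).
  by move=> [i j]; exact: h.
exists (\max_ij k ij) => M kM i j.
have kle : (k (i, j) <= M)%N := leq_trans (leq_bigmax _) kM.
by rewrite -(subnK kle) exprD -mulrA; apply: ideal2Ml; exact: hk (i, j).
Qed.

(** * Dimension count in one large bidegree *)

Section Count.

Variables (f g : cox K) (d1 d2 e1 e2 : nat).
Hypotheses (hf : bihomog (d1%:Z, d2%:Z) f) (hg : bihomog (e1%:Z, e2%:Z) g).
Hypotheses (f_neq0 : f != 0) (g_neq0 : g != 0).

(* The multiples of f g lie in the intersection of the two spaces. *)
Lemma dim_ideal2_le s t s' t' :
  s' = (s + d1 + e1)%N -> t' = (t + d2 + e2)%N ->
  (\dim (multiples s' t' f (s + e1) (t + e2) +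
         multiples s' t' g (s + d1) (t + d2)) + s.+1 * t.+1 <=
   (s + e1).+1 * (t + e2).+1 + (s + d1).+1 * (t + d2).+1)%N.
Proof.
move=> s'E t'E.
have hfg : bihomog ((d1 + e1)%:Z, (d2 + e2)%:Z) (f * g).
  exact: (bihomogM_nat hf hg).
have sub : (multiples s' t' (f * g) s t <=
  multiples s' t' f (s + e1) (t + e2) :&: multiples s' t' g (s + d1) (t + d2))%VS.
  apply/subvP => P.
  move/(@multiplesP _ s' t' _ s t _ _ hfg ltac:(lia) ltac:(lia)) => [q hq e].
  rewrite memv_cap; apply/andP; split.
    apply/(@multiplesP _ s' t' _ (s + e1) (t + e2) _ _ hf ltac:(lia) ltac:(lia)).
    exists (q * g); last by rewrite e; ring.
    exact: (bihomogM_nat hq hg).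
  apply/(@multiplesP _ s' t' _ (s + d1) (t + d2) _ _ hg ltac:(lia) ltac:(lia)).
  exists (q * f); last by rewrite e; ring.
  exact: (bihomogM_nat hq hf).
have := dimvS sub; rewrite (dim_multiples hfg) ?mulf_neq0 //; try lia.
have := dimv_sum_cap (multiples s' t' f (s + e1) (t + e2))
                     (multiples s' t' g (s + d1) (t + d2)).
rewrite (dim_multiples hf) //; try lia.
rewrite (dim_multiples hg) //; lia.
Qed.

Lemma ideal2_multiples s t s1 t1 s2 t2 (P : 'M[K]_(s.+1, t.+1)) :
  s = (s1 + d1)%N -> t = (t1 + d2)%N -> s = (s2 + e1)%N -> t = (t2 + e2)%N ->
  ideal2 f g (form_of P) ->
  P \in (multiples s t f s1 t1 + multiples s t g s2 t2)%VS.
Proof.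
move=> es1 et1 es2 et2 [c [d e]]; rewrite -[P]form_ofK e linearD /=.
apply: memv_add; first exact: coefs_multiples hf _ _ _.
exact: coefs_multiples hg _ _ _.
Qed.

Variables (l1 l2 p1 p2 : cox K) (m n : nat).
Hypotheses (hl1 : bihomog (0%:Z, 1%:Z) l1) (hl2 : bihomog (0%:Z, 1%:Z) l2).
Hypotheses (hp1 : bihomog (m%:Z, 0%:Z) p1) (hp2 : bihomog (n%:Z, 0%:Z) p2).
Hypotheses (l1_neq0 : l1 != 0) (l2_neq0 : l2 != 0).
Hypotheses (p1_neq0 : p1 != 0) (p2_neq0 : p2 != 0).
(** Modulo [l1 * l2], a multiple of [p1 * l2] of degree t in y reduces to a form in x times
    [p1 * l2 ^+ t], and symmetrically for [p2 * l1]. The powers thus lose no dimension and make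
    independence checkable on the two rulings. *)
Hypothesis free : forall t s1 s2 q q1 q2, (0 < t)%N ->
  bihomog (s1%:Z, 0%:Z) q1 -> bihomog (s2%:Z, 0%:Z) q2 ->
  q * (l1 * l2) = q1 * (p1 * l2 ^+ t) + q2 * (p2 * l1 ^+ t) ->
  q1 = 0 /\ q2 = 0.

(* On the left are the dimensions in bidegree (s, t) of the multiples of l1 l2,
   p1 l2^t and p2 l1^t, whose sum is direct by [free] and lies in (f, g), and of
   the multiples of f g; on the right those of the multiples of f and of g. *)
Lemma count_of_free N s t s1 s2 t0 t' sf tf sg tg S T :
  (forall p, p \in [:: l1 * l2; p1 * l2; p2 * l1] ->
     forall i j, ideal2 f g ((xvar K i * yvar K j) ^+ N * p)) ->
  s = (s1 + m)%N -> s = (s2 + n)%N -> t = t0.+2 -> t = t'.+1 ->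
  (N.*2 <= s1)%N -> (N.*2 <= s2)%N -> (N.*2 <= t0)%N ->
  s = (sf + d1)%N -> t = (tf + d2)%N -> s = (sg + e1)%N -> t = (tg + e2)%N ->
  sf = (S + e1)%N -> tf = (T + e2)%N -> sg = (S + d1)%N -> tg = (T + d2)%N ->
  (s.+1 * t0.+1 + (s1.+1 + s2.+1) + S.+1 * T.+1 <=
     sf.+1 * tf.+1 + sg.+1 * tg.+1)%N.
Proof.
move=> hN sE1 sE2 tE0 tE' N1 N2 N0 sfE tfE sgE tgE sfE' tfE' sgE' tgE'.
have Ns : (N.*2 <= s)%N by rewrite sE1 (leq_trans N1) ?leq_addr.
have Nt' : (N.*2 <= t')%N by move: tE'; rewrite tE0 => - [<-]; exact: ltnW.
have sE : s = (s + 0)%N by rewrite addn0.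
have tE : t = (0 + t)%N by [].
have tE2 : t = (t0 + 2)%N by rewrite addn2.
have high1 := ideal2_high_degree (hN (l1 * l2) ltac:(by rewrite inE eqxx)).
have high2 := ideal2_high_degree (hN (p1 * l2) ltac:(by rewrite !inE eqxx orbT)).
have high3 := ideal2_high_degree
  (hN (p2 * l1) ltac:(by rewrite !inE eqxx !orbT)).
pose J := (multiples s t f sf tf + multiples s t g sg tg)%VS.
have dimJ : (\dim J + S.+1 * T.+1 <= sf.+1 * tf.+1 + sg.+1 * tg.+1)%N.
  rewrite /J; subst sf tf sg tg; apply: dim_ideal2_le.
    by rewrite sfE addnAC.
  by rewrite tfE addnAC.
pose L0 := multiples s t (l1 * l2) s t0.
pose L1 := multiples s t (p1 * l2 ^+ t) s1 0.
pose L2 := multiples s t (p2 * l1 ^+ t) s2 0.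
have h0 : bihomog (0%:Z, 2%:Z) (l1 * l2) by apply: (bihomogM_nat hl1 hl2).
have h1 : bihomog (m%:Z, t%:Z) (p1 * l2 ^+ t).
  by apply: (bihomogM_nat hp1 (bihomog_yexp hl2)); rewrite ?addn0.
have h2 : bihomog (n%:Z, t%:Z) (p2 * l1 ^+ t).
  by apply: (bihomogM_nat hp2 (bihomog_yexp hl1)); rewrite ?addn0.
have L0P P := @multiplesP _ s t _ s t0 _ _ h0 sE tE2 P.
have L1P P := @multiplesP _ s t _ s1 0 _ _ h1 sE1 tE P.
have L2P P := @multiplesP _ s t _ s2 0 _ _ h2 sE2 tE P.
have LJ : (L0 + (L1 + L2) <= J)%VS.
  rewrite !subv_add; apply/and3P; split; apply/subvP => P.
  - case/L0P => q hq e; apply: ideal2_multiples => //.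
    by rewrite e; exact: high1 hq Ns N0.
  - case/L1P => q hq e; apply: ideal2_multiples => //.
    have -> : form_of P = (q * l2 ^+ t') * (p1 * l2).
      by rewrite e tE' exprSr; ring.
    apply: (high2 _ s1 t') => //.
    by apply: (bihomogM_nat hq (bihomog_yexp hl2)); rewrite ?addn0.
  - case/L2P => q hq e; apply: ideal2_multiples => //.
    have -> : form_of P = (q * l1 ^+ t') * (p2 * l1).
      by rewrite e tE' exprSr; ring.
    apply: (high3 _ s2 t') => //.
    by apply: (bihomogM_nat hq (bihomog_yexp hl1)); rewrite ?addn0.
have t_gt0 : (0 < t)%N by rewrite tE'.
have L12 : (L1 :&: L2 = 0)%VS.
  apply/eqP; rewrite -subv0; apply/subvP => P; rewrite memv_cap.
  case/andP => /L1P [q hq e] /L2P [q' hq' e'].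
  have [|q0 _] := free (q := 0) t_gt0 hq (bihomogN (p := q') hq').
    by rewrite mulNr -e -e' subrr mul0r.
  have P0 : form_of P = 0 by rewrite e q0 mul0r.
  by rewrite memv0 -[P]form_ofK P0 linear0.
have L012 : (L0 :&: (L1 + L2) = 0)%VS.
  apply/eqP; rewrite -subv0; apply/subvP => P; rewrite memv_cap.
  case/andP => /L0P [q hq e] /memv_addP [P1 /L1P [q1 hq1 f1]].
  case=> [P2 /L2P [q2 hq2 f2] ePP].
  have eP : form_of P = q1 * (p1 * l2 ^+ t) + q2 * (p2 * l1 ^+ t).
    by rewrite ePP linearD -f1 -f2.
  have [|q10 q20] := free (q := q) t_gt0 hq1 hq2; first by rewrite -eP -e.
  have P0 : form_of P = 0 by rewrite eP; exact: comb0.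
  by rewrite memv0 -[P]form_ofK P0 linear0.
have := dimvS LJ; rewrite (dimv_disjoint_sum L012) (dimv_disjoint_sum L12).
rewrite (dim_multiples h0 _ sE tE2) ?mulf_neq0 //.
rewrite (dim_multiples h1 _ sE1 tE) ?mulf_neq0 ?expf_neq0 //.
rewrite (dim_multiples h2 _ sE2 tE) ?mulf_neq0 ?expf_neq0 // !muln1 => dL.
by apply: (leq_trans _ dimJ); rewrite leq_add2r.
Qed.

Lemma bezout_of_free :
  (forall p, p \in [:: l1 * l2; p1 * l2; p2 * l1] ->
     forall i j, exists k, ideal2 f g ((xvar K i * yvar K j) ^+ k * p)) ->
  (d1 * e2 + d2 * e1 <= m + n)%N.
Proof.
move=> hJ.
have [N1 hN1] := ideal2_uniform (hJ _ (mem_head _ _)).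
have [N2 hN2] := ideal2_uniform (hJ (p1 * l2) ltac:(by rewrite !inE eqxx orbT)).
have [N3 hN3] := ideal2_uniform (hJ (p2 * l1) ltac:(by rewrite !inE eqxx !orbT)).
pose N := (N1 + N2 + N3)%N.
have hN p : p \in [:: l1 * l2; p1 * l2; p2 * l1] ->
    forall i j, ideal2 f g ((xvar K i * yvar K j) ^+ N * p).
  rewrite !inE => /or3P [] /eqP -> i j.
  - by apply: hN1; rewrite /N -addnA leq_addr.
  - by apply: hN2; rewrite /N addnAC leq_addl.
  - by apply: hN3; rewrite leq_addl.
(* (S, T) is the bidegree of the cofactors of [f * g]. The summand m + n keeps s - m and s - n above
   2N, and the 2 in T does the same for t - 2, as [ideal2_high_degree] requires. *)
pose S := (m + n + N.*2)%N; pose T := (N.*2).+2.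
have := @count_of_free N (S + d1 + e1) (T + d2 + e2) (n + N.*2 + d1 + e1)
  (m + N.*2 + d1 + e1) (N.*2 + d2 + e2) (N.*2 + d2 + e2).+1
  (S + e1) (T + e2) (S + d1) (T + d2) S T hN.
move: (N.*2) @S @T => M S T; rewrite {}/S {}/T; clear => H.
(* With s = S + d1 + e1 and t = T + d2 + e2, the first two summands on the left make (s+1)(t+1) - (m
   + n), and the right side minus (S+1)(T+1) is (s+1)(t+1) - (d1 e2 + d2 e1). *)
suff : ((m + n + M + d1 + e1).+1 * (M + d2 + e2).+1
        + ((n + M + d1 + e1).+1 + (m + M + d1 + e1).+1)
        + (m + n + M).+1 * M.+3
        <= (m + n + M + e1).+1 * (M.+2 + e2).+1
           + (m + n + M + d1).+1 * (M.+2 + d2).+1)%N by clear H; nia.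
by apply: H; lia.
Qed.

End Count.

(** On y = b1 every term but [q1 * p1 * l2 ^+ t] vanishes. Since [q1 * p1] has degree 0 in y,
    vanishing on this one ruling makes it zero; y = b2 does the same for [q2 * p2]. *)
Lemma ruling_forms_free (A1 A2 : seq (P1 K)) (b1 b2 : P1 K) q q1 q2 s1 s2 t :
  b1 != b2 -> (0 < t)%N ->
  bihomog (s1%:Z, 0%:Z) q1 -> bihomog (s2%:Z, 0%:Z) q2 ->
  q * (yform b1 * yform b2) =
    q1 * (\prod_(a <- A1) xform a * yform b2 ^+ t) +
    q2 * (\prod_(a <- A2) xform a * yform b1 ^+ t) ->
  q1 = 0 /\ q2 = 0.
Proof.
move: (prod_xform_neq0 A1) (prod_xform_neq0 A2).
move: (bihomog_prod_xform A1) (bihomog_prod_xform A2).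
move: (\prod_(a <- A1) _) (\prod_(a <- A2) _) => p1 p2 hp1 hp2 p1_neq0 p2_neq0.
move=> b12 t_gt0 h1 h2 e.
have hq1 : bihomog ((s1 + size A1)%:Z, 0%:Z) (q1 * p1).
  by apply: (bihomogM_nat h1 hp1).
have hq2 : bihomog ((s2 + size A2)%:Z, 0%:Z) (q2 * p2).
  by apply: (bihomogM_nat h2 hp2).
have eve u v : ev q u v * ldot b1 v * ldot b2 v =
    ev (q1 * p1) u v * ldot b2 v ^+ t + ev (q2 * p2) u v * ldot b1 v ^+ t.
  have := congr1 (fun z => ev z u v) e; rewrite !mulrA.
  rewrite -!(ev_yform _ u); move: (yform b1) (yform b2) => l1 l2.
  rewrite (evD (_ * _ * _) (_ * _ * _)) (evM (q * l1) l2) (evM q l1).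
  rewrite (evM (q1 * p1) (l2 ^+ t)) (evM (q2 * p2) (l1 ^+ t)).
  by rewrite (evXn l1) (evXn l2).
have b12' : ldot b2 (rep b1) != 0 by rewrite ldot_rep_eq0 eq_sym.
have b21' : ldot b1 (rep b2) != 0 by rewrite ldot_rep_eq0.
have e1_ : q1 * p1 = 0.
  apply: mpoly_zero => w; have [u [v ->]] := evP (q1 * p1) w.
  rewrite (ev_ydeg0 _ _ (rep b1) hq1).
  have /eqP := eve u (rep b1); rewrite ldot_rep mulr0 mul0r expr0n.
  rewrite (gtn_eqF t_gt0) mulr0 addr0 eq_sym mulf_eq0 expf_eq0.
  by rewrite (negPf b12') andbF orbF => /eqP.
have e2_ : q2 * p2 = 0.
  apply: mpoly_zero => w; have [u [v ->]] := evP (q2 * p2) w.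
  rewrite (ev_ydeg0 _ _ (rep b2) hq2).
  have /eqP := eve u (rep b2); rewrite ldot_rep mulr0 expr0n (gtn_eqF t_gt0).
  rewrite mulr0 add0r eq_sym mulf_eq0 expf_eq0.
  by rewrite (negPf b21') andbF orbF => /eqP.
split; apply/eqP.
  by move/eqP: e1_; rewrite mulf_eq0 (negPf p1_neq0) orbF.
by move/eqP: e2_; rewrite mulf_eq0 (negPf p2_neq0) orbF.
Qed.

Lemma bezout_le f g d1 d2 e1 e2 (A1 A2 : seq (P1 K)) (b1 b2 : P1 K) :
  bihomog (d1%:Z, d2%:Z) f -> bihomog (e1%:Z, e2%:Z) g -> f != 0 -> g != 0 ->
  b1 != b2 ->
  (forall p, p \in [:: yform b1 * yform b2; \prod_(a <- A1) xform a * yform b2;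
                       \prod_(a <- A2) xform a * yform b1] ->
     forall i j, exists k, ideal2 f g ((xvar K i * yvar K j) ^+ k * p)) ->
  (d1 * e2 + d2 * e1 <= size A1 + size A2)%N.
Proof.
move=> hf hg f_neq0 g_neq0 b12.
apply: (bezout_of_free hf hg f_neq0 g_neq0 (bihomog_yform b1) (bihomog_yform b2)
  (bihomog_prod_xform A1) (bihomog_prod_xform A2)).
- exact/linform_neq0/yvec_neq0.
- exact/linform_neq0/yvec_neq0.
- exact: prod_xform_neq0.
- exact: prod_xform_neq0.
- by move=> t s1 s2 q q1 q2; exact: ruling_forms_free.
Qed.

End Bezout.

(** * Sheaf isomorphisms of cyclic modules *)

Section CyclicModules.

Variable K : closedFieldType.
Notation S := (cox K).
Implicit Types (h p q : S).

Definition is_ideal (I : S -> Prop) :=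
  [/\ I 0, forall p q, I p -> I q -> I (p + q) & forall c p, I p -> I (c * p)].

(** Covers both S / I_X and the cokernel of a Koszul complex, whose relations come in different
    shapes; [RI] and [QJ] translate them into ideals of S. *)
Definition cyclic_module (R : 'rV[S]_1 -> Prop) : gmodule K :=
  @GModule K 1 (fun=> 0) R.

Section SectionEq.

Variables (I : S -> Prop) (R : 'rV[S]_1 -> Prop).
Hypotheses (idI : is_ideal I) (RI : forall v, R v <-> I (v 0 0)).
Let M := cyclic_module R.

Lemma section_eqE h (s t : Defs.frac M) : section_eq h s t <->
  exists k, I (h ^+ k * (h ^+ t.2 * s.1 0 0 - h ^+ s.2 * t.1 0 0)).
Proof.
by split=> [[k /RI Rk]|[k Ik]]; exists k; [move: Rk | apply/RI; move: Ik];
  rewrite !mxE.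
Qed.

Lemma section_eq_sym h (s t : Defs.frac M) : section_eq h s t -> section_eq h t s.
Proof.
have [_ _ IM] := idI; move/section_eqE => [k /(IM (-1)) Ik].
by apply/section_eqE; exists k; move: Ik; congr I; ring.
Qed.

Lemma section_eq_trans h (s t r : Defs.frac M) :
  section_eq h s t -> section_eq h t r -> section_eq h s r.
Proof.
have [_ ID IM] := idI.
move=> /section_eqE [k I1] /section_eqE [l I2].
apply/section_eqE; exists (k + l + t.2)%N.
have := ID _ _ (IM (h ^+ (l + r.2)) _ I1) (IM (h ^+ (k + s.2)) _ I2).
by congr I; rewrite !exprD; ring.
Qed.

Lemma section_eq_scale h a (s t : Defs.frac M) :
  section_eq h s t -> section_eq h (section_scale a s) (section_scale a t).
Proof.
have [_ _ IM] := idI.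
move=> /section_eqE [k I1]; apply/section_eqE; exists k.
have := IM (h ^+ a.2 * a.1) _ I1.
by congr I; rewrite /section_scale /= !mxE !exprD; ring.
Qed.

Lemma is_section_scale h a (s : Defs.frac M) :
  is_function h a -> is_section h s -> is_section h (section_scale a s).
Proof.
move=> [d [hd ha]] [e [he hs]]; exists (d + e); split.
  by rewrite exprD; exact: (bihomogM hd he).
by move=> i; rewrite !mxE -addrA; exact: (bihomogM ha (hs i)).
Qed.

Definition section_one : Defs.frac M := (const_mx 1, 0%N).

Lemma is_section_one h : is_section h section_one.
Proof.
exists 0; split; first by rewrite expr0; exact: bihomog1.
by move=> i; rewrite mxE subr0; exact: bihomog1.
Qed.

Lemma is_function0 h : is_function h (0, 0%N).
Proof.
exists 0; split; first by rewrite expr0; exact: bihomog1.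
exact: bihomog0.
Qed.

End SectionEq.

Section SheafIso.

Variables (I J : S -> Prop) (R Q : 'rV[S]_1 -> Prop).
Hypotheses (idI : is_ideal I) (RI : forall v, R v <-> I (v 0 0)).
Hypotheses (idJ : is_ideal J) (QJ : forall v, Q v <-> J (v 0 0)).
Let M := cyclic_module R.
Let N := cyclic_module Q.

(* Local sections of M are killed by I, so the section of M corresponding to
   the section 1 of N = S/J shows that I is locally contained in J. *)
Lemma sheaf_iso_annihilator h a n : sheaf_iso M N -> basic_open h ->
  is_function h (a, n) -> I a -> exists k, J (h ^+ k * a).
Proof.
have [_ _ IM] := idI.
move=> [phi [/(_ h) isoh _]] hh ha Ia.
have [_ pinj psurj _ pscale] := isoh hh.
have [s s_sec s1] := psurj _ (is_section_one Q h).
have f0 := is_function0 h.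
have s_sec_a := is_section_scale ha s_sec.
have s_sec_0 := is_section_scale f0 s_sec.
have as0 : section_eq h (section_scale (a, n) s) (section_scale (0, 0%N) s).
  apply/(section_eqE RI); exists 0%N; rewrite !mxE /=.
  have := IM (h ^+ s.2 * s.1 0 0) _ Ia; congr I.
  by rewrite expr0 ?add0n; ring.
have pas0 := (pinj _ _ s_sec_a s_sec_0).2 as0.
have e1 := section_eq_scale idJ QJ (a, n) s1.
have e2 := pscale _ _ ha s_sec.
have e3 := pscale _ _ f0 s_sec.
have := section_eq_trans idJ QJ (section_eq_sym idJ QJ e1)
  (section_eq_trans idJ QJ (section_eq_sym idJ QJ e2)
    (section_eq_trans idJ QJ pas0 e3)).
move/(section_eqE QJ) => [k]; rewrite !mxE /= => Jk.
exists (k + (phi h s).2)%N; move: Jk; congr J.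
by rewrite !exprD expr0; ring.
Qed.

(** The image of the section 1 of M is killed by J, and injectivity carries this back to 1. *)
Lemma sheaf_iso_annihilator_inv h a n : sheaf_iso M N -> basic_open h ->
  is_function h (a, n) -> J a -> exists k, I (h ^+ k * a).
Proof.
have [_ _ JM] := idJ.
move=> [phi [/(_ h) isoh _]] hh ha Ja.
have [_ pinj _ _ pscale] := isoh hh.
have o := is_section_one R h; have f0 := is_function0 h.
have as0 (s : Defs.frac N) :
    section_eq h (section_scale (a, n) s) (section_scale (0, 0%N) s).
  apply/(section_eqE QJ); exists 0%N; rewrite !mxE /=.
  have := JM (h ^+ s.2 * s.1 0 0) _ Ja; congr J.
  by rewrite expr0 ?add0n; ring.
have := section_eq_trans idJ QJ (pscale _ _ ha o)
  (section_eq_trans idJ QJ (as0 _) (section_eq_sym idJ QJ (pscale _ _ f0 o))).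
move/(pinj _ _ (is_section_scale ha o) (is_section_scale f0 o)).1.
move/(section_eqE RI) => [k]; rewrite !mxE /= => Ik.
by exists k; move: Ik; congr I; rewrite !exprD expr0; ring.
Qed.

(** The isomorphism is the identity on representatives: J inside I makes it reflect equality in one
    direction, the local inclusion of I in J in the other. *)
Lemma sheaf_iso_of_local_eq :
  (forall p, J p -> I p) ->
  (forall h p, basic_open h -> I p -> exists k, J (h ^+ k * p)) ->
  sheaf_iso M N.
Proof.
have [J0 _ _] := idJ; move=> JI IJ.
have refl h (s : Defs.frac N) : section_eq h s s.
  by apply/(section_eqE QJ); exists 0%N; rewrite subrr mulr0.
exists (fun _ s => s); split=> [h hh|h h' r k hh hh' e s _]; last exact: refl.
split=> // [s t _ _|t ts].
- split=> [/(section_eqE QJ) [k Jk]|/(section_eqE RI) [k Ik]].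
    by apply/(section_eqE RI); exists k; exact: JI.
  have [l Jl] := IJ _ _ hh Ik; apply/(section_eqE QJ); exists (l + k)%N.
  by rewrite exprD -mulrA.
- by exists t => //; exact: refl.
Qed.

End SheafIso.

End CyclicModules.

(** * Binary forms and the numerical argument *)

Section BinaryForms.

Variable K : closedFieldType.
Implicit Types (u v : 'rV[K]_2).

(** Phrased for functions, so that the restriction of a form of S to a ruling is an instance without
    further translation. *)
Definition is_binary_form d (F : 'rV[K]_2 -> K) := exists a : nat -> K,
  forall u, F u = \sum_(i < d.+1) a i * (u 0 0 ^+ i * u 0 1 ^+ (d - i)).

Definition mkrV2 (x y : K) : 'rV[K]_2 := \row_i (if i == 0 then x else y).

Lemma binary_form_horner d F (a : nat -> K) :
  (forall u, F u = \sum_(i < d.+1) a i * (u 0 0 ^+ i * u 0 1 ^+ (d - i))) ->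
  forall u, u 0 1 != 0 ->
  F u = u 0 1 ^+ d * (\poly_(i < d.+1) a i).[u 0 0 / u 0 1].
Proof.
move=> Fa u u1; rewrite Fa horner_poly mulr_sumr; apply: eq_bigr => i _.
have -> : u 0 1 ^+ d = u 0 1 ^+ (d - i) * u 0 1 ^+ i.
  by rewrite -exprD subnK // leq_ord.
rewrite exprMn exprVn; have := expf_neq0 i u1.
by move: (_ ^+ i) (_ ^+ (d - i)) => x y yi; field.
Qed.

Lemma binary_form_dec d F : is_binary_form d F ->
  (forall u, F u = 0) \/ (exists u, F u != 0).
Proof.
move=> [a Fa]; pose q := \poly_(i < d.+1) a i.
have [q0|q0] := eqVneq q 0.
  left=> u; rewrite Fa big1 // => i _.
  have /polyP/(_ i) := q0; rewrite coef_poly ltn_ord coef0 => ->.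
  by rewrite mul0r.
have /closed_nonrootP [t qt] := q0.
right; exists (mkrV2 t 1); rewrite (binary_form_horner Fa) !mxE /= ?oner_neq0 //.
by rewrite divr1 expr1n mul1r.
Qed.

Lemma binary_form_roots d F (A : seq (P1 K)) : is_binary_form d F ->
  uniq A -> (forall l, l \in A -> F (rep l) = 0) -> (exists u, F u != 0) ->
  (size A <= d)%N.
Proof.
move=> [a Fa] A_uniq FA [u0 Fu0]; pose q := \poly_(i < d.+1) a i.
have q_neq0 : q != 0.
  apply: contra_neq Fu0 => q0; rewrite Fa big1 // => i _.
  have /polyP/(_ i) := q0; rewrite coef_poly ltn_ord coef0 => ->.
  by rewrite mul0r.
have size_q : (size q <= d.+1)%N := size_poly _ _.
pose inf : pred (P1 K) := fun l => rep l 0 1 == 0.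
pose r (l : P1 K) := rep l 0 0 / rep l 0 1.
have count_fin : (count (predC inf) A < size q)%N.
  rewrite -size_filter -(size_map r); apply: max_poly_roots => //.
    apply/allP => x /mapP [l + ->]; rewrite mem_filter => /andP [l1 lA].
    rewrite rootE.
    have := FA l lA; rewrite (binary_form_horner Fa) // => /eqP.
    by rewrite mulf_eq0 expf_eq0 [rep l 0 1 == 0](negPf l1) andbF.
  rewrite map_inj_in_uniq ?filter_uniq // => l l'.
  rewrite !mem_filter => /andP [l1 _] /andP [l'1 _] e.
  have {}l1 : rep l 0 1 != 0 := l1; have {}l'1 : rep l' 0 1 != 0 := l'1.
  apply/eqP; rewrite -ldot_rep_eq0 /ldot subr_eq0; apply/eqP.
  transitivity (rep l 0 1 * rep l' 0 1 * r l'); first by rewrite /r; field.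
  by rewrite -e /r; field.
(* A line on which the second coordinate vanishes is a root at infinity, which
   lowers the degree of q. *)
rewrite -(count_predC inf A).
have [/hasP [l lA l1]|] := boolP (has inf A); last first.
  by rewrite has_count -leqNgt leqn0 => /eqP ->; lia.
have count_inf : (count inf A <= 1)%N.
  rewrite -size_filter; have : uniq (filter inf A) by exact: filter_uniq.
  have same l' : l' \in filter inf A -> l' = l.
    rewrite mem_filter => /andP [l'1 _]; apply/eqP.
    by rewrite -ldot_rep_eq0 /ldot (eqP l1) (eqP l'1) mul0r mulr0 subrr.
  case: (filter inf A) same => [|x [|y s]] //= same /andP [xs _].
  have ex := same x (mem_head _ _).
  have ey := same y ltac:(by rewrite !inE eqxx orbT).
  by move: xs; rewrite ex ey mem_head.
suff : (size q <= d)%N by lia.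
have l0 : rep l 0 0 != 0.
  apply: contra_neq (rep_neq0 l) => l0; apply: rV2P; rewrite mxE //.
  exact/eqP.
have ad : a d = 0.
  have /eqP := FA l lA; rewrite Fa big_ord_recr /= big1 => [|i _].
    by rewrite add0r subnn mulr1 mulf_eq0 expf_eq0 (negPf l0) andbF orbF => /eqP.
  by rewrite (eqP l1) expr0n subn_eq0 leqNgt ltn_ord !mulr0.
apply/leq_sizeP => j dj; rewrite coef_poly; case: ifP => // jd.
by rewrite (_ : j = d) //; lia.
Qed.

Lemma ev_form_of s t (M : 'M[K]_(s.+1, t.+1)) u v : ev (form_of M) u v =
  \sum_i \sum_j M i j * (u 0 0 ^+ i * u 0 1 ^+ (s - i) *
                         (v 0 0 ^+ j * v 0 1 ^+ (t - j))).
Proof.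
rewrite /ev raddf_sum; apply: eq_bigr => i _; rewrite raddf_sum.
apply: eq_bigr => j _; rewrite /= mevalZ mevalX big_split_ord /= !big_ord2 /=.
by rewrite !row_mxEl !row_mxEr !mnmE.
Qed.

Lemma binary_form_x (f : cox K) d1 d2 v : bihomog (d1%:Z, d2%:Z) f ->
  is_binary_form d1 (fun u => ev f u v).
Proof.
move=> hf; exists (fun i => \sum_(j < d2.+1)
  coefs d1 d2 f (inord i) j * (v 0 0 ^+ j * v 0 1 ^+ (d2 - j))) => u.
rewrite -{1}(coefsK hf) ev_form_of; apply: eq_bigr => i _.
rewrite mulr_suml; apply: eq_bigr => j _; rewrite inord_val -!mulrA.
by congr (_ * _); rewrite mulrA mulrC mulrA.
Qed.

Lemma binary_form_y (f : cox K) d1 d2 u : bihomog (d1%:Z, d2%:Z) f ->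
  is_binary_form d2 (fun v => ev f u v).
Proof.
move=> hf; exists (fun j => \sum_(i < d1.+1)
  coefs d1 d2 f i (inord j) * (u 0 0 ^+ i * u 0 1 ^+ (d1 - i))) => v.
rewrite -{1}(coefsK hf) ev_form_of exchange_big; apply: eq_bigr => j _.
by rewrite mulr_suml; apply: eq_bigr => i _; rewrite inord_val -!mulrA.
Qed.

End BinaryForms.

(** * Degree bounds from zeros on three rulings *)

Section Numerics.

Variables (K : closedFieldType) (f g : cox K) (d1 d2 e1 e2 : nat).
Hypotheses (hf : bihomog (d1%:Z, d2%:Z) f) (hg : bihomog (e1%:Z, e2%:Z) g).
Hypotheses (f_neq0 : f != 0) (g_neq0 : g != 0).
Variables (A1 A2 : seq (P1 K)) (b1 b2 : P1 K).
Hypotheses (b12 : b1 != b2) (A1_uniq : uniq A1) (A2_uniq : uniq A2).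

Definition vanishes_on (p : cox K) (A : seq (P1 K)) (b : P1 K) :=
  forall l, l \in A -> ev p (rep l) (rep b) = 0.

Lemma neq0_ev (p : cox K) : p != 0 -> exists u v, ev p u v != 0.
Proof.
by move=> /mpoly_nonroot [w]; have [u [v ->]] := evP p w; exists u, v.
Qed.

Definition local_gens (l1 l2 p1 p2 : cox K) :=
  forall p, p \in [:: l1 * l2; p1 * l2; p2 * l1] ->
  forall i j, exists k, ideal2 f g ((xvar K i * yvar K j) ^+ k * p).

Lemma ev_xvar i (u v : 'rV[K]_2) : ev (xvar K i) u v = u 0 i.
Proof. by rewrite /ev mevalXU row_mxEl. Qed.

Lemma ev_yvar i (u v : 'rV[K]_2) : ev (yvar K i) u v = v 0 i.
Proof. by rewrite /ev mevalXU row_mxEr. Qed.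

(* A common zero of f and g off the zeros of p contradicts (x_i y_j)^k p in
   (f, g). *)
Lemma local_gen_no_zero (p : cox K) (u v : 'rV[K]_2) :
  (forall i j, exists k, ideal2 f g ((xvar K i * yvar K j) ^+ k * p)) ->
  u != 0 -> v != 0 -> ev p u v != 0 -> ev f u v = 0 -> ev g u v = 0 -> False.
Proof.
move=> hp /rV0Pn [i ui] /rV0Pn [j vj] pn f0 g0.
have [k [c [d /(congr1 (fun z => ev z u v))]]] := hp i j.
rewrite evD (evM c) (evM d) f0 g0 !mulr0 addr0 (evM _ p) evXn evM.
rewrite ev_xvar ev_yvar => /eqP.
by rewrite !mulf_eq0 expf_eq0 mulf_eq0 (negPf ui) (negPf vj) (negPf pn) andbF.
Qed.

(** Write m, n for the two sizes. As f and g cannot both vanish on x = a, say f does not; then d2 >=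
    2. If g vanishes identically on neither y = b1 nor y = b2, then e1 >= max(m, n). If on both, f
    vanishes on neither, so e2 >= 2 and d1 >= max(m, n). Either way 2 max(m, n) <= m + n. If on
    exactly one, d1 e2 + d2 e1 is at least m + 2n or n + 2m, which is too large. *)
Lemma sizes_eq (a : P1 K) : a \in A1 -> a \in A2 ->
  vanishes_on f A1 b1 -> vanishes_on f A2 b2 ->
  vanishes_on g A1 b1 -> vanishes_on g A2 b2 ->
  local_gens (yform b1) (yform b2)
    (\prod_(l <- A1) xform l) (\prod_(l <- A2) xform l) ->
  size A1 = size A2.
Proof.
move=> a1 a2 f1 f2 g1 g2 loc.
have bez := bezout_le hf hg f_neq0 g_neq0 b12 loc.
have m1 : (0 < size A1)%N by case: (A1) a1.
have n1 : (0 < size A2)%N by case: (A2) a2.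
have u_bb : uniq [:: b1; b2] by rewrite /= inE b12.
have [uf [vf fuv]] := neq0_ev f_neq0.
have [ug [vg guv]] := neq0_ev g_neq0.
have ab1 : ldot b1 (rep b2) != 0 by rewrite ldot_rep_eq0.
have ab2 : ldot b2 (rep b1) != 0 by rewrite ldot_rep_eq0 eq_sym.
have not_a : (forall v, ev f (rep a) v = 0) ->
    (forall v, ev g (rep a) v = 0) -> False.
  (* This v lies on neither of the lines b1, b2, so [yform b1 * yform b2] is nonzero at the common
     zero (a, v). *)
  move=> fa ga; pose v := rep b1 + rep b2.
  have lv b : ldot b v = ldot b (rep b1) + ldot b (rep b2).
    by rewrite /ldot !mxE; ring.
  have lv1 : ldot b1 v != 0 by rewrite lv ldot_rep add0r.
  have lv2 : ldot b2 v != 0 by rewrite lv ldot_rep addr0.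
  apply: (local_gen_no_zero (p := yform b1 * yform b2)
    (u := rep a) (v := v)) => //.
  - by apply: loc; rewrite inE eqxx.
  - exact: rep_neq0.
  - by apply: contra_neq lv1 => ->; rewrite /ldot !mxE !mulr0 subrr.
  - by rewrite evM !ev_yform mulf_neq0.
(* On y = b, a point u off the zeros of the product is a common zero of f and g at which the chosen
   generator is nonzero. Nonemptiness of A makes the product vanish at 0, so u is nonzero. *)
have not_b (A : seq (P1 K)) b b' : a \in A -> ldot b' (rep b) != 0 ->
    \prod_(l <- A) xform l * yform b' \in [:: yform b1 * yform b2;
      \prod_(l <- A1) xform l * yform b2; \prod_(l <- A2) xform l * yform b1] ->
    (forall u, ev f u (rep b) = 0) -> (forall u, ev g u (rep b) = 0) -> False.
  move=> aA bb' pin fb gb.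
  have [u [v]] := neq0_ev (prod_xform_neq0 A).
  rewrite ev_prod_xform => pu.
  apply: (local_gen_no_zero (u := u) (v := rep b) (loc _ pin)) => //.
  - apply: contra_neq pu => ->; rewrite (big_rem a) //= /ldot !mxE !mulr0.
    by rewrite subrr mul0r.
  - exact: rep_neq0.
  - by rewrite evM ev_prod_xform ev_yform mulf_neq0.
have not_b1 := not_b A1 b1 b2 a1 ab2 ltac:(by rewrite !inE eqxx orbT).
have not_b2 := not_b A2 b2 b1 a2 ab1 ltac:(by rewrite !inE eqxx !orbT).
(* If p restricts to zero on a ruling, p itself is still nonzero, so along some transversal ruling
   it has a zero and positive degree. *)
have key (p : cox K) c1 c2 : bihomog (c1%:Z, c2%:Z) p -> p != 0 ->
    vanishes_on p A1 b1 -> vanishes_on p A2 b2 ->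
  [/\ (forall v, ev p (rep a) v = 0) /\ (1 <= c1)%N \/ (2 <= c2)%N,
      (forall u, ev p u (rep b1) = 0) /\ (1 <= c2)%N \/ (size A1 <= c1)%N,
      (forall u, ev p u (rep b2) = 0) /\ (1 <= c2)%N \/ (size A2 <= c1)%N &
      (forall u, ev p u (rep b1) = 0) -> (forall u, ev p u (rep b2) = 0) ->
      (2 <= c2)%N].
Proof.
  move=> hp p_neq0 p1 p2; have [u [v puv]] := neq0_ev p_neq0.
  have x1 w := binary_form_x w hp; have y1 w := binary_form_y w hp.
  split.
  - have [pa|pa] := binary_form_dec (y1 (rep a)).
      left; split=> //; apply: (binary_form_roots (A := [:: a]) (x1 v)) => //.
        by move=> l; rewrite inE => /eqP ->.
      by exists u.
    right; apply: (binary_form_roots (A := [:: b1; b2]) (y1 (rep a))) => //.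
    by move=> b; rewrite !inE => /orP [] /eqP ->; [exact: p1 | exact: p2].
  - have [pb|pb] := binary_form_dec (x1 (rep b1)); [left | right].
      split=> //; apply: (binary_form_roots (A := [:: b1]) (y1 u)) => //.
        by move=> l; rewrite inE => /eqP ->.
      by exists v.
    exact: binary_form_roots (x1 (rep b1)) A1_uniq p1 pb.
  - have [pb|pb] := binary_form_dec (x1 (rep b2)); [left | right].
      split=> //; apply: (binary_form_roots (A := [:: b2]) (y1 u)) => //.
        by move=> l; rewrite inE => /eqP ->.
      by exists v.
    exact: binary_form_roots (x1 (rep b2)) A2_uniq p2 pb.
  - move=> pb1 pb2; apply: (binary_form_roots (A := [:: b1; b2]) (y1 u)) => //.
      by move=> b; rewrite !inE => /orP [] /eqP ->.
    by exists v.
have [fa fb1 fb2 fbb] := key f d1 d2 hf f_neq0 f1 f2.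
have [ga gb1 gb2 gbb] := key g e1 e2 hg g_neq0 g1 g2.
suff arith m n : size A1 = m -> size A2 = n -> m = n by exact: arith.
move=> em en; rewrite em en in bez m1 n1 fb1 fb2 gb1 gb2.
case: fa => [[fa fa']|fa]; case: ga => [[ga ga']|ga]; try by case: not_a.
all: case: fb1 => [[fb1 fb1']|fb1]; case: gb1 => [[gb1 gb1']|gb1];
  try by case: not_b1.
all: case: fb2 => [[fb2 fb2']|fb2]; case: gb2 => [[gb2 gb2']|gb2];
  try by case: not_b2.
all: try (have {}fbb := fbb fb1 fb2).
all: try (have {}gbb := gbb gb1 gb2).
all: clear loc key not_a not_b not_b1 not_b2 hf hg f1 f2 g1 g2 fuv guv.
all: clear f_neq0 g_neq0 A1_uniq A2_uniq b12 ab1 ab2 u_bb.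
all: nia.
Qed.

End Numerics.

(** * Consequences of a virtual resolution by a Koszul complex *)

Section VirtualCompleteIntersections.

Variable K : closedFieldType.
Notation S := (cox K).
Implicit Types (f g h p : S) (X : {fset P1xP1 K}).

Lemma is_ideal_vanishing X : is_ideal (vanishing_ideal X).
Proof.
split=> [q qX u v uq vq|p p' hp hp' q qX u v uq vq|c p hp q qX u v uq vq].
- by rewrite meval0.
- by rewrite mevalD (hp q) ?(hp' q) ?addr0.
- by rewrite mevalM (hp q) ?mulr0.
Qed.

Lemma is_ideal_ideal2 f g : is_ideal (ideal2 f g).
Proof.
split; [exact: ideal2_0 | exact: ideal2D | move=> c p; exact: ideal2Ml].
Qed.

Lemma koszul_coker f g (v : 'rV[S]_1) :
  (exists w : 'rV_2, v = w *m koszul_diff f g 0) <-> ideal2 f g (v 0 0).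
Proof.
have wE (w : 'rV[S]_2) :
    (w *m koszul_diff f g 0) 0 0 = w 0 0 * f + w 0 1 * g.
  by rewrite mxE big_ord2 !mxE.
split=> [[w ->]|[c [d e]]]; first by exists (w 0 0), (w 0 1).
exists (\row_i (if i == 0 then c else d)); apply/rowP => i.
by rewrite (ord1 i) wE !mxE.
Qed.

Lemma bihomog_nat d f : bihomog d f -> f != 0 ->
  exists d1 d2 : nat, d = (d1%:Z, d2%:Z).
Proof.
rewrite -msupp_eq0 => hf; case E: (msupp f) => [//|m s] _.
by rewrite -(hf m) ?E ?mem_head //; eexists; eexists.
Qed.

Lemma xy_basic i j : basic_open (xvar K i * yvar K j).
Proof.
split; last by eexists; exact: (bihomogM (bihomog_xvar i) (bihomog_yvar j)).
split.
  exists (fun k => (k == i)%:R * yvar K j).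
  rewrite (bigD1 i) //= eqxx big1 => [|k /negPf ->]; first by rewrite /=; ring.
  by rewrite mul0r mul0r.
exists (fun k => (k == j)%:R * xvar K i).
rewrite (bigD1 j) //= eqxx big1 => [|k /negPf ->]; first by rewrite /=; ring.
by rewrite mul0r mul0r.
Qed.

(* Multiplying by x_i^t y_j^s brings a form of bidegree (s, t) to the degree of
   a power of x_i y_j. *)
Lemma xy_function i j p s t : bihomog (s%:Z, t%:Z) p ->
  is_function (xvar K i * yvar K j)
    (xvar K i ^+ t * yvar K j ^+ s * p, (s + t)%N).
Proof.
have hx k : bihomog (k%:Z, 0%:Z) (xvar K i ^+ k).
  elim: k => [|k IHk]; first by rewrite expr0; exact: bihomog1.
  by rewrite exprS; exact: (bihomogM_nat (bihomog_xvar i) IHk).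
have hy k : bihomog (0%:Z, k%:Z) (yvar K j ^+ k) := bihomog_yexp (bihomog_yvar j).
move=> hp; exists ((s + t)%:Z, (s + t)%:Z); split => /=.
  by rewrite exprMn; apply: (bihomogM_nat (hx _) (hy _)); rewrite ?addn0.
have hxy : bihomog (t%:Z, s%:Z) (xvar K i ^+ t * yvar K j ^+ s).
  by apply: (bihomogM_nat (hx t) (hy s)); rewrite ?addn0.
by apply: (bihomogM_nat hxy hp) => //; exact: addnC.
Qed.

Section Forward.

Variables (X : {fset P1xP1 K}) (d e : int * int) (f g : S).
Hypotheses (hf : bihomog d f) (hg : bihomog e g).
Hypothesis res : virtual_resolution (vanishing_ideal X) (koszul hf hg).

Let idI := is_ideal_vanishing X.
Let idJ := is_ideal_ideal2 f g.

Let iso : sheaf_iso (cyclic_module (fun v => vanishing_ideal X (v 0 0)))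
  (cyclic_module (fun v => exists w : 'rV_2, v = w *m koszul_diff f g 0)) :=
  res.2.

Lemma vci_local_mem p s t : bihomog (s%:Z, t%:Z) p -> vanishing_ideal X p ->
  forall i j, exists k, ideal2 f g ((xvar K i * yvar K j) ^+ k * p).
Proof.
move=> hp Ip i j; have [_ _ IM] := idI.
have [k] := sheaf_iso_annihilator idI (fun=> iff_refl _) idJ (koszul_coker f g)
  iso (xy_basic i j) (xy_function i j hp) (IM _ _ Ip).
move/(ideal2Ml (xvar K i ^+ s * yvar K j ^+ t)) => H.
exists (k + (s + t))%N; move: H; congr ideal2.
by rewrite !exprMn !exprD; ring.
Qed.

Lemma vci_vanish p d0 : bihomog d0 p -> ideal2 f g p ->
  forall q, q \in X -> ev p (rep q.1) (rep q.2) = 0.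
Proof.
move=> hp Jp q qX; have [->|p0] := eqVneq p 0; first exact: meval0.
have [s [t d0E]] := bihomog_nat hp p0; rewrite d0E in hp.
have [i ui] := rV0Pn _ (rep_neq0 q.1).
have [j vj] := rV0Pn _ (rep_neq0 q.2).
have [k Ik] := sheaf_iso_annihilator_inv (fun=> iff_refl _) idJ
  (koszul_coker f g) iso (xy_basic i j) (xy_function i j hp)
  (ideal2Ml _ Jp).
have := Ik q qX _ _ (rep_mem q.1) (rep_mem q.2).
rewrite -/(ev _ _ _) (evM (_ ^+ k)) evXn evM (evM _ p) (evM (_ ^+ t)) !evXn.
rewrite ev_xvar ev_yvar => /eqP.
rewrite !mulf_eq0 !expf_eq0 mulf_eq0 (negPf ui) (negPf vj) !andbF /=.
by move/eqP.
Qed.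

Lemma vci_vanish_fg q : q \in X ->
  ev f (rep q.1) (rep q.2) = 0 /\ ev g (rep q.1) (rep q.2) = 0.
Proof.
move=> qX; split.
  by apply: vci_vanish hf _ _ qX; exists 1, 0; ring.
by apply: vci_vanish hg _ _ qX; exists 0, 1; ring.
Qed.

(** If f = 0 then (1, 0) is a cycle, and the boundaries are the multiples of (-g, f); a power of x_i
    y_j would then be a multiple of g, although g vanishes at q and x_i y_j can be chosen not to.
    Symmetrically for g = 0. *)
Lemma vci_neq0 q : q \in X -> f != 0 /\ g != 0.
Proof.
move=> qX; have [f0 g0] := vci_vanish_fg qX.
have [i ui] := rV0Pn _ (rep_neq0 q.1).
have [j vj] := rV0Pn _ (rep_neq0 q.2).
have [l l0 kill] := res.1 0%N.
pose s : S := (xvar K i * yvar K j) ^+ l.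
have sB : ideal_pow (@irrelevant_ideal K) l s.
  exists 1%N, (fun=> 1), (fun _ _ => xvar K i * yvar K j); split=> [_ _|].
    by have [] := xy_basic i j.
  by rewrite big_ord1 mul1r prodr_const card_ord.
have sn : ev s (rep q.1) (rep q.2) != 0.
  by rewrite evXn evM ev_xvar ev_yvar expf_neq0 ?mulf_neq0.
have contra (v : 'rV[S]_2) k : v *m koszul_diff f g 0 = 0 -> v 0 k = 1 -> False.
  move=> v0 vk; have [w /rowP/(_ k)] := kill s sB v v0.
  rewrite mxE vk mulr1 mxE big_ord1 mxE => sE.
  move: sn; rewrite sE; case: ifP => _; rewrite evM.
    by rewrite /ev mevalN -/(ev g _ _) g0 oppr0 mulr0 eqxx.
  by rewrite f0 mulr0 eqxx.
split; apply/eqP => z.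
  apply: (contra (\row_i (if i == 0 then 1 else 0)) 0); last by rewrite mxE.
  apply/rowP => c; rewrite mxE big_ord2 !mxE /= z; ring.
apply: (contra (\row_i (if i == 0 then 0 else 1)) 1); last by rewrite mxE.
by apply/rowP => c; rewrite mxE big_ord2 !mxE /= z; ring.
Qed.

End Forward.

(** * Points of X on one horizontal ruling *)

Definition fiber X (b : P1 K) : seq (P1 K) := [seq z.1 | z <- X & z.2 == b].

Lemma mem_fiber X b a : (a \in fiber X b) = ((a, b) \in X).
Proof.
apply/mapP/idP => [[[x y]]|abX].
  by rewrite mem_filter /= => /andP [/eqP -> xbX] ->.
by exists (a, b); rewrite // mem_filter eqxx.
Qed.

Lemma fiber_uniq X b : uniq (fiber X b).
Proof.
rewrite map_inj_in_uniq ?filter_uniq ?fset_uniq // => - [x y] [x' y'].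
by rewrite !mem_filter /= => /andP [/eqP -> _] /andP [/eqP -> _] ->.
Qed.

Lemma size_fiber X b :
  size (fiber X b) = #|` [fset z in X | z \in horizontal_ruling b]%fset |.
Proof.
rewrite size_map -(size_map id) map_id; apply/perm_size/uniq_perm.
- by rewrite filter_uniq ?fset_uniq.
- exact: fset_uniq.
- by move=> p; rewrite mem_filter !inE andbC.
Qed.

Lemma vanishing_yform X (b : P1 K) (q : P1xP1 K) u v :
  q \in X -> v \in val q.2 -> q.2 = b -> ev (yform b) u v = 0.
Proof.
by move=> _ vq qb; rewrite ev_yform -qb; apply/eqP; rewrite -mem_line.
Qed.

Lemma vanishing_prod_xform X (b : P1 K) (q : P1xP1 K) u v : q \in X -> q.2 = b ->
  u \in val q.1 -> ev (\prod_(l <- fiber X b) xform l) u v = 0.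
Proof.
move=> qX qb; rewrite mem_line => /eqP uq; rewrite ev_prod_xform.
have q1 : q.1 \in fiber X b by rewrite mem_fiber -qb; case: (q) qX.
by rewrite (big_rem _ q1) /= uq mul0r.
Qed.

Lemma vci_fibers_eq X b1 b2 a : b1 != b2 ->
  (forall q, q \in X -> q.2 = b1 \/ q.2 = b2) ->
  a \in fiber X b1 -> a \in fiber X b2 ->
  virtual_complete_intersection X ->
  size (fiber X b1) = size (fiber X b2).
Proof.
move=> b12 Xb a1 a2 [d [e [f [g [hf [hg res]]]]]].
have qX : (a, b1) \in X by rewrite -mem_fiber.
have [f0 g0] := vci_neq0 res qX.
have [d1 [d2 dE]] := bihomog_nat hf f0.
have [e1 [e2 eE]] := bihomog_nat hg g0.
subst d e.
have van := vci_vanish_fg res.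
have loc := vci_local_mem res.
apply: (sizes_eq hf hg f0 g0 b12 (fiber_uniq X b1) (fiber_uniq X b2) a1 a2).
- by move=> l; rewrite mem_fiber => /van [].
- by move=> l; rewrite mem_fiber => /van [].
- by move=> l; rewrite mem_fiber => /van [].
- by move=> l; rewrite mem_fiber => /van [].
move=> p; rewrite !inE => /or3P [] /eqP ->.
- apply: (loc _ 0%N 2%N).
    exact: (bihomogM_nat (bihomog_yform b1) (bihomog_yform b2)).
  move=> q qX' u v uq vq; rewrite -/(ev _ _ _) evM.
  by have [qb|qb] := Xb q qX'; rewrite (vanishing_yform u qX' vq qb)
    ?mulr0 ?mul0r.
- apply: (loc _ (size (fiber X b1)) 1%N).
    by apply: (bihomogM_nat (bihomog_prod_xform _) (bihomog_yform b2));
      rewrite ?addn0.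
  move=> q qX' u v uq vq; rewrite -/(ev _ _ _) evM; have [qb|qb] := Xb q qX'.
    by rewrite (vanishing_prod_xform v qX' qb uq) mul0r.
  by rewrite (vanishing_yform u qX' vq qb) mulr0.
- apply: (loc _ (size (fiber X b2)) 1%N).
    by apply: (bihomogM_nat (bihomog_prod_xform _) (bihomog_yform b1));
      rewrite ?addn0.
  move=> q qX' u v uq vq; rewrite -/(ev _ _ _) evM; have [qb|qb] := Xb q qX'.
    by rewrite (vanishing_yform u qX' vq qb) mulr0.
  by rewrite (vanishing_prod_xform v qX' qb uq) mul0r.
Qed.

End VirtualCompleteIntersections.

(** * Construction of virtual complete intersections *)

Section Comaximal.

Variable R : comNzRingType.
Implicit Types (h u v w p f g : R).

(** Says that u and v generate the unit ideal once h is inverted, so that membership on D(h) may be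
    tested after multiplying by u and by v. *)
Definition comaximal_at h u v := exists k, ideal2 u v (h ^+ k).

Lemma comaximal_sym h u v : comaximal_at h u v -> comaximal_at h v u.
Proof. by move=> [k [c [d e]]]; exists k, d, c; rewrite e addrC. Qed.

Lemma comaximalM h u v w :
  comaximal_at h u v -> comaximal_at h u w -> comaximal_at h u (v * w).
Proof.
move=> [k [c [d e]]] [k' [c' [d' e']]]; exists (k + k')%N.
exists (c * c' * u + c * d' * w + d * v * c'), (d * d').
by rewrite exprD e e'; ring.
Qed.

Lemma comaximal1 h u : comaximal_at h u 1.
Proof. by exists 0%N, 0, 1; rewrite expr0; ring. Qed.

Lemma comaximalXn h u v n : comaximal_at h u v -> comaximal_at h u (v ^+ n).
Proof.
move=> huv; elim: n => [|n IHn]; first by rewrite expr0; exact: comaximal1.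
by rewrite exprS; exact: comaximalM.
Qed.

Lemma comaximal_prod (T : eqType) (s : seq T) (F : T -> R) h u :
  (forall a, a \in s -> comaximal_at h u (F a)) ->
  comaximal_at h u (\prod_(a <- s) F a).
Proof.
move=> hF; rewrite big_seq; elim/big_ind: _ => //.
  exact: comaximal1.
by move=> v w; exact: comaximalM.
Qed.

Lemma comaximal_colon h u v f g p : comaximal_at h u v ->
  ideal2 f g (u * p) -> ideal2 f g (v * p) -> exists k, ideal2 f g (h ^+ k * p).
Proof.
move=> [k [c [d e]]] Ju Jv; exists k; rewrite e mulrDl -!mulrA.
by apply: ideal2D; exact: ideal2Ml.
Qed.

End Comaximal.

Section Converse.

Variable K : closedFieldType.
Notation S := (cox K).
Implicit Types (f g h p : S) (X : {fset P1xP1 K}) (a b : P1 K).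

(* By Cramer's rule two independent linear forms in z0, z1 generate z0 and z1. *)
Lemma comaximal_lines (z0 z1 c0 c1 : S) a b : a != b ->
  comaximal_at (c0 * z0 + c1 * z1) (rep a 0 1 *: z0 - rep a 0 0 *: z1)
                                   (rep b 0 1 *: z0 - rep b 0 0 *: z1).
Proof.
move=> ab; exists 1%N; pose D := ldot a (rep b).
have D1 : D%:MP * D^-1%:MP = 1 :> S by rewrite -mpolyCM mulfV // ldot_rep_eq0.
exists (D^-1%:MP * (c0 * (rep b 0 0)%:MP + c1 * (rep b 0 1)%:MP)).
exists (- (D^-1%:MP * (c0 * (rep a 0 0)%:MP + c1 * (rep a 0 1)%:MP))).
rewrite expr1 -[LHS]mulr1 -{}D1 -!mul_mpolyC /D /ldot mpolyCB !mpolyCM; ring.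
Qed.

Lemma comaximal_xform h a b : ideal_gen (@xvar K) h -> a != b ->
  comaximal_at h (xform a) (xform b).
Proof.
by move=> [c ->]; rewrite big_ord2 !xformE; exact: comaximal_lines.
Qed.

Lemma comaximal_yform h a b : ideal_gen (@yvar K) h -> a != b ->
  comaximal_at h (yform a) (yform b).
Proof.
by move=> [c ->]; rewrite big_ord2 !yformE; exact: comaximal_lines.
Qed.

Lemma vci_of_koszul X (T : eqType) (F : T -> 'rV[K]_(2 + 2)) (s : seq T) d e f g :
  bihomog d f -> bihomog e g ->
  uniq s -> (forall x, x \in s -> F x != 0) ->
  (forall x y, x \in s -> y \in s -> x != y ->
     ~ divides (linform (F x)) (linform (F y))) ->
  f = \prod_(x <- s) linform (F x) ->
  (forall x, x \in s -> ~ divides (linform (F x)) g) ->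
  vanishing_ideal X f -> vanishing_ideal X g ->
  (forall h p, irrelevant_ideal h -> vanishing_ideal X p ->
     exists k, ideal2 f g (h ^+ k * p)) ->
  virtual_complete_intersection X.
Proof.
move=> hf hg s_uniq F0 Fndvd fE gndvd If Ig loc.
have f_neq0 : f != 0 by rewrite fE; exact: prod_linform_neq0.
exists d, e, f, g, hf, hg; split; last first.
  apply: (sheaf_iso_of_local_eq (fun=> iff_refl _) (is_ideal_ideal2 f g)
    (koszul_coker f g)).
    have [_ ID IM] := is_ideal_vanishing X.
    by move=> _ [c [c' ->]]; apply: ID; exact: IM.
  by move=> h p [hB _]; exact: loc.
(* The positive homology is zero, so every element annihilates it and the exponent 1 serves. *)
move=> i; exists 1%N => // r _; case: i => [|[|i]] /= v v0.
- have vfg : v 0 0 * \prod_(x <- s) linform (F x) + v 0 1 * g = 0.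
    by have /rowP/(_ 0) := v0; rewrite mxE big_ord2 !mxE /= -fE.
  have [w [e0 e1]] := prod_linform_koszul F0 s_uniq Fndvd gndvd vfg.
  exists (const_mx (r * w)); apply/rowP => k; rewrite !mxE big_ord1 !mxE /=.
  have [->|->] : k = 0 \/ k = 1.
    by case: k => - [|[|//]] ?; [left | right]; apply: val_inj.
    by rewrite e0 /=; ring.
  by rewrite e1 -fE /=; ring.
- exists 0; have /rowP/(_ 1) := v0; rewrite mxE big_ord1 !mxE /= => /eqP.
  rewrite mulf_eq0 (negPf f_neq0) orbF => /eqP v00.
  by apply/rowP => k; rewrite mul0mx !mxE (ord1 k) v00 mulr0.
- by exists 0; apply/rowP => - [].
Qed.

(** Divide p by [yform b]. The remainder is p composed with a projection onto y = b that fixes the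
    x-coordinates, so it vanishes wherever [xform a] does, for each a in the fiber; these primes are
    distinct, so their product divides it. *)
Lemma vanishing_decomp X b p : vanishing_ideal X p ->
  exists s t, p = \prod_(a <- fiber X b) xform a * s + yform b * t.
Proof.
move=> Ip; have /rV0Pn [j bj] := perp_neq0 b.
have bj' : yvec b 0 (rshift 2 j) != 0 by rewrite row_mxEr.
have [t [r [pE rE]]] := linform_div p bj'.
have [s rs] : divides (\prod_(a <- fiber X b) xform a) r.
  apply: prod_linform_dvd => [a _|||a].
  - exact: xvec_neq0.
  - exact: fiber_uniq.
  - by move=> a a' _ _; exact: xform_ndvd.
  rewrite mem_fiber => abX; apply: (linform_dvd (xvec_neq0 a)) => w aw.
  rewrite rE; set w' := fun i => _.
  have aw' : (xform a).@[w'] = 0.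
    by rewrite meval_linform_sub aw row_mxEr mxE mul0r subrr.
  have bw' : (yform b).@[w'] = 0 by exact: meval_linform_proj.
  have [u [v uv]] := row_mxP w'; rewrite (meval_eq p uv).
  rewrite (meval_eq _ uv) in aw'; rewrite (meval_eq _ uv) in bw'.
  apply: (Ip (a, b)) => //=; rewrite mem_line.
    by rewrite -(ev_xform a u v) /ev aw'.
  by rewrite -(ev_yform b u v) /ev bw'.
by exists s, t; rewrite pE rs addrC.
Qed.

(* Otherwise unification evaluates the fibers in order to compare them. *)
Opaque fiber.

(** * The two explicit pairs of forms *)

Section TwoRulings.

Variables (X : {fset P1xP1 K}) (b1 b2 : P1 K).
Hypothesis b12 : b1 != b2.
Hypothesis Xb : forall q, q \in X -> q.2 = b1 \/ q.2 = b2.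

Notation A1 := (fiber X b1).
Notation A2 := (fiber X b2).

Let ndot1 : ldot b1 (rep b2) != 0. Proof. by rewrite ldot_rep_eq0. Qed.
Let ndot2 : ldot b2 (rep b1) != 0. Proof. by rewrite ldot_rep_eq0 eq_sym. Qed.

Lemma vci_equal_fibers : size A1 = size A2 -> virtual_complete_intersection X.
Proof.
move=> sizes.
(* The products are kept abstract: unification diverges when it unfolds them. *)
have [p1 p1E] : exists p : S, p = \prod_(a <- A1) xform a
  by exact: (ex_intro _ _ erefl).
have [p2 p2E] : exists p : S, p = \prod_(a <- A2) xform a
  by exact: (ex_intro _ _ erefl).
have hp1 : bihomog ((size A1)%:Z, 0%:Z) p1.
  by rewrite p1E; exact: bihomog_prod_xform.
have hp2 : bihomog ((size A2)%:Z, 0%:Z) p2.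
  by rewrite p2E; exact: bihomog_prod_xform.
pose f : S := yform b1 * yform b2; pose g : S := p1 * yform b2 + p2 * yform b1.
apply: (@vci_of_koszul X _ (@yvec K) [:: b1; b2]
  (0%:Z, 2%:Z) ((size A1)%:Z, 1%:Z) f g).
- exact: (bihomogM_nat (bihomog_yform b1) (bihomog_yform b2)).
- apply: bihomogD.
    exact: (bihomogM_nat hp1 (bihomog_yform b2) (esym (addn0 _)) erefl).
  rewrite sizes.
  exact: (bihomogM_nat hp2 (bihomog_yform b1) (esym (addn0 _)) erefl).
- by rewrite /= inE b12.
- by move=> b _; exact: yvec_neq0.
- by move=> b b' _ _; exact: yform_ndvd.
- by rewrite !big_cons big_nil mulr1.
- have nz A b b' : ldot b' (rep b) != 0 -> forall p,
      divides (yform b) (\prod_(a <- A) xform a * yform b' + p * yform b) ->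
      False.
    move=> bb' p; have [u [v]] := neq0_ev (prod_xform_neq0 A).
    rewrite ev_prod_xform => pu /(divides_ev (u := u) (v := rep b)).
    rewrite ev_yform ldot_rep => /(_ erefl) /eqP.
    rewrite evD !evM !ev_yform ldot_rep ev_prod_xform mulr0 addr0 mulf_eq0.
    by rewrite (negPf pu) (negPf bb').
  move=> b; rewrite !inE /g p1E p2E => /orP [] /eqP ->; first exact: nz.
  by rewrite addrC; exact: nz.
- move=> q qX u v uq vq; rewrite -/(ev _ _ _) evM.
  by have [qb|qb] := Xb qX; rewrite (vanishing_yform _ qX vq qb) ?mulr0 ?mul0r.
- move=> q qX u v uq vq; rewrite -/(ev _ _ _).
  rewrite (evD (p1 * _) (p2 * _)) (evM p1) (evM p2).
  have [qb|qb] := Xb qX.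
    have z : ev p1 u v = 0 by rewrite p1E; exact: vanishing_prod_xform qX qb uq.
    by rewrite z (vanishing_yform u qX vq qb) mulr0 mul0r addr0.
  have z : ev p2 u v = 0 by rewrite p2E; exact: vanishing_prod_xform qX qb uq.
  by rewrite z (vanishing_yform u qX vq qb) mulr0 mul0r addr0.
- move=> h p [_ hy] Ip.
  have [s [t e]] := vanishing_decomp b1 Ip.
  have [s' [t' e']] := vanishing_decomp b2 Ip.
  (* Writing l1, l2 for the two y-forms: l2 g is congruent to p1 l2^2 modulo f = l1 l2, so l2^2
     brings both p1 and l1 into (f, g); l1^2 does the same for p2 and l2. *)
  apply: (comaximal_colon (u := yform b2 ^+ 2) (v := yform b1 ^+ 2)).
  + by apply/comaximalXn/comaximal_sym/comaximalXn; exact: comaximal_yform.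
  + rewrite e; exists (yform b2 * t - p2 * s), (yform b2 * s).
    by rewrite -p1E /f /g; ring.
  + rewrite e'; exists (yform b1 * t' - p1 * s'), (yform b1 * s').
    by rewrite -p2E /f /g; ring.
Qed.

Lemma vci_disjoint_fibers : A1 != [::] -> A2 != [::] ->
  (forall a, a \in A1 -> a \notin A2) -> virtual_complete_intersection X.
Proof.
move=> A1_neq0 A2_neq0 dis.
have [m mE] : exists m, m = size A1 by exact: (ex_intro _ _ erefl).
have [n nE] : exists n, n = size A2 by exact: (ex_intro _ _ erefl).
have m0 : m != 0%N by rewrite mE; case: (A1) A1_neq0.
have n0 : n != 0%N by rewrite nE; case: (A2) A2_neq0.
have [p1 p1E] : exists p : S, p = \prod_(a <- A1) xform a
  by exact: (ex_intro _ _ erefl).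
have [p2 p2E] : exists p : S, p = \prod_(a <- A2) xform a
  by exact: (ex_intro _ _ erefl).
have hp1 : bihomog (m%:Z, 0%:Z) p1 by rewrite p1E mE; exact: bihomog_prod_xform.
have hp2 : bihomog (n%:Z, 0%:Z) p2 by rewrite p2E nE; exact: bihomog_prod_xform.
have m1 : m = m.-1.+1 by rewrite prednK // lt0n.
have n1 : n = n.-1.+1 by rewrite prednK // lt0n.
pose f : S := p1 * p2.
pose g : S := p2 ^+ m * yform b1 + p1 ^+ n * yform b2.
have hX c k (p : S) : bihomog (c%:Z, 0%:Z) p ->
    bihomog ((c * k)%:Z, 0%:Z) (p ^+ k).
  move=> hp; elim: k => [|k IHk]; first by rewrite muln0 expr0; exact: bihomog1.
  by rewrite exprS mulnS; exact: (bihomogM_nat hp IHk).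
have nz A a : a \notin A -> \prod_(l <- A) ldot l (rep a) != 0.
  move=> aA; rewrite prodf_seq_neq0; apply/allP => l lA /=.
  by rewrite ldot_rep_eq0; apply: contraNneq aA => <-.
have evg u v : ev g u v = ev p2 u v ^+ m * ldot b1 v + ev p1 u v ^+ n * ldot b2 v.
  rewrite (evD (p2 ^+ m * _) (p1 ^+ n * _)) (evM (p1 ^+ n)) (evM (p2 ^+ m)).
  by rewrite (evXn p1) (evXn p2) (ev_yform b1) (ev_yform b2).
apply: (@vci_of_koszul X _ (@xvec K) (A1 ++ A2)
  ((m + n)%:Z, 0%:Z) ((m * n)%:Z, 1%:Z) f g).
- exact: (bihomogM_nat hp1 hp2).
- apply: bihomogD.
    rewrite mulnC.
    exact: (bihomogM_nat (hX _ m _ hp2) (bihomog_yform b1)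
      (esym (addn0 _)) erefl).
  exact: (bihomogM_nat (hX _ n _ hp1) (bihomog_yform b2)
    (esym (addn0 _)) erefl).
- rewrite cat_uniq; apply/and3P; split; [exact: fiber_uniq | | exact: fiber_uniq].
  by apply/hasPn => a a2; apply/negP => /dis /negP; exact.
- by move=> a _; exact: xvec_neq0.
- by move=> a a' _ _; exact: xform_ndvd.
- by rewrite big_cat /f p1E p2E.
- move=> a; rewrite mem_cat => /orP [] aA.
    (* At (a, b2) with a in A1 the second term of g vanishes, while p2^m [yform b1] is nonzero
       because a is not in A2. *)
    move/(divides_ev (u := rep a) (v := rep b2)).
    rewrite ev_xform ldot_rep evg (ldot_rep b2) mulr0 addr0 => /(_ erefl) /eqP.
    rewrite mulf_eq0 expf_eq0 (negPf ndot1) p2E ev_prod_xform.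
    by rewrite (negPf (nz _ _ (dis _ aA))) andbF.
  move/(divides_ev (u := rep a) (v := rep b1)).
  rewrite ev_xform ldot_rep evg (ldot_rep b1) mulr0 add0r => /(_ erefl) /eqP.
  rewrite mulf_eq0 expf_eq0 (negPf ndot2) p1E ev_prod_xform.
  have aA1 : a \notin A1 by apply/negP => /dis /negP; exact.
  by rewrite (negPf (nz _ _ aA1)) andbF.
- move=> q qX u v uq vq; rewrite -/(ev _ _ _) (evM p1); have [qb|qb] := Xb qX.
    have z : ev p1 u v = 0 by rewrite p1E; exact: vanishing_prod_xform qX qb uq.
    by rewrite z mul0r.
  have z : ev p2 u v = 0 by rewrite p2E; exact: vanishing_prod_xform qX qb uq.
  by rewrite z mulr0.
- move=> q qX u v uq vq; rewrite -/(ev _ _ _).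
  rewrite evg -(ev_yform b1 u) -(ev_yform b2 u); have [qb|qb] := Xb qX.
    have z : ev p1 u v = 0 by rewrite p1E; exact: vanishing_prod_xform qX qb uq.
    by rewrite z (vanishing_yform u qX vq qb) expr0n (negPf n0) mulr0 mul0r addr0.
  have z : ev p2 u v = 0 by rewrite p2E; exact: vanishing_prod_xform qX qb uq.
  by rewrite z (vanishing_yform u qX vq qb) expr0n (negPf m0) mulr0 mul0r addr0.
- move=> h p [hx _] Ip.
  have [s [t e]] := vanishing_decomp b1 Ip.
  have [s' [t' e']] := vanishing_decomp b2 Ip.
  (* One factor p2 turns p1, and hence p1^n since n > 0, into a multiple of f; so p2 g is congruent
     to p2^(m+1) [yform b1] modulo f. The other multiplier is symmetric and uses m > 0. *)
  apply: (comaximal_colon (u := p2 ^+ m.+1) (v := p1 ^+ n.+1)).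
  + apply/comaximalXn/comaximal_sym/comaximalXn; rewrite p1E p2E.
    apply: comaximal_prod => a a2; apply: comaximal_sym.
    apply: comaximal_prod => a' a1; apply: comaximal_xform => //.
    by apply: contraTneq a2 => ->; exact: dis.
  + exists (p2 ^+ m * s - p1 ^+ n.-1 * yform b2 * t), (p2 * t).
    rewrite e -p1E /f /g {2}n1 !exprS; ring.
  + exists (p1 ^+ n * s' - p2 ^+ m.-1 * yform b1 * t'), (p1 * t').
    rewrite e' -p2E /f /g {2}m1 !exprS; ring.
Qed.

End TwoRulings.

End Converse.

Local Open Scope fset_scope.

Theorem theorem5p1 (K : closedFieldType) (X : {fset P1xP1 K}) (b1 b2 : P1 K)
    (b1_neq_b2 : b1 <> b2)
    (X_sub : forall p, p \in X ->
       p \in horizontal_ruling b1 \/ p \in horizontal_ruling b2)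
    (X_b1 : exists p, p \in X /\ p \in horizontal_ruling b1)
    (X_b2 : exists p, p \in X /\ p \in horizontal_ruling b2) :
  virtual_complete_intersection X <->
    (forall p q, p \in X -> q \in X -> p <> q ->
       ~ exists a : P1 K, p \in vertical_ruling a /\ q \in vertical_ruling a)
    \/ #|` [fset p in X | p \in horizontal_ruling b1]|
       = #|` [fset p in X | p \in horizontal_ruling b2]|.
Proof.
have b12 : b1 != b2 by apply/eqP.
have Xb q : q \in X -> q.2 = b1 \/ q.2 = b2.
  by move=> /X_sub [] /eqP qb; [left | right].
have fiber_nonempty b : (exists p, p \in X /\ p \in horizontal_ruling b) ->
    fiber X b != [::].
  move=> [[a c] [pX /eqP /= cb]]; rewrite cb -mem_fiber in pX.
  by apply: contraTneq pX => ->.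
have s1 := size_fiber X b1; have s2 := size_fiber X b2.
split=> [vci|[dis|sizes]].
- have [/hasP [a a1 a2]|nocommon] := boolP (has (mem (fiber X b2)) (fiber X b1)).
    right; have sizes := vci_fibers_eq b12 Xb a1 a2 vci.
    exact: etrans (esym s1) (etrans sizes s2).
  left=> - [x y] [x' y'] pX qX pq [a [/eqP /= xa /eqP /= x'a]].
  subst x x'; have common : a \in fiber X b1 -> a \in fiber X b2 -> False.
    by move=> a1 a2; move/hasPn/(_ _ a1)/negP: nocommon.
  (* Distinct points over the same a cannot share a horizontal ruling, so a would lie in both
     fibers. *)
  have [/= yb|/= yb] := Xb _ pX; have [/= yb'|/= yb'] := Xb _ qX;
    subst y y' => //;
    by apply: common; rewrite mem_fiber.
- apply: (vci_disjoint_fibers b12 Xb); [exact: fiber_nonempty.. |].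
  move=> a aA1; apply/negP => aA2.
  have aX : (a, b1) \in X := etrans (esym (mem_fiber X b1 a)) aA1.
  have aX' : (a, b2) \in X := etrans (esym (mem_fiber X b2 a)) aA2.
  apply: (dis _ _ aX aX'); first by case.
  by exists a; split; exact: eqxx.
- exact: vci_equal_fibers b12 Xb (etrans s1 (etrans sizes (esym s2))).
Qed.
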